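(* Let $(X,d)$ be a compact metric space and $f:X\to X$ a continuous map. Let $\mathbf a=(a_n)_{n\ge1}$ be a sequence in $\mathbb N$ that is uniformly behaved in $\mathbb N$. Suppose $f$ is $\mathbf a$-minimally mean attractable ($\mathbf a$-MMA) and minimally uniquely ergodic $\mathbf a$-mean Lyapunov stable ($\mathbf a$-MUEMLS). Then for every continuous function $\phi:X\to\mathbb C$, every minimal subset $K\subseteq X$ and every $x\in\mathrm{Basin}(K)$, $$\lim_{N\to\infty}\frac1N\sum_{n=1}^N\phi(f^{a_n}x)=\int_K\phi\,d\nu_K,$$ where $\nu_K$ is the unique $f|_K$-invariant Borel probability measure on $K$.
   Context: $\mathbb N$ is the set of natural numbers, $f^0=\mathrm{Id}$. $\mathbf a$ is uniformly behaved in $\mathbb N$ if for every real $0<\theta<1$, $\lim_{N\to\infty}\frac1N\sum_{n=1}^N e^{2\pi i a_n\theta}=0$. For $E\subset\mathbb N$, $\overline D_{\mathbf a}(E)=\limsup_{N\to\infty}\frac1N\#\{1\le n\le N: a_n\in E\}$. A continuous self-map $g$ of a compact metric space $(Y,d)$ is $\mathbf a$-mean Lyapunov stable ($\mathbf a$-MLS) if for every $\epsilon>0$ there are $\delta>0$ and a set $E=E_\epsilon\subset\mathbb N$ with $\overline D_{\mathbf a}(E)<\epsilon$ such that for all $x,y\in Y$ with $d(x,y)<\delta$ one has $d(g^{a_n}x,g^{a_n}y)<\epsilon$ for all $n\ge1$ with $a_n\notin E$. A minimal subset is a nonempty closed $K\subseteq X$ with $f(K)\subseteq K$ such that every orbit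 $\{f^nx\}_{n\ge0}$, $x\in K$, is dense in $K$. $f$ is $\mathbf a$-MUEMLS if for every minimal subset $K$, $f:K\to K$ is uniquely ergodic (has exactly one invariant Borel probability measure) and $\mathbf a$-MLS. A point $x\in X$ is $\mathbf a$-mean attracted to $K$ if for every $\epsilon>0$ there is $z\in K$ with $\limsup_{N\to\infty}\frac1N\sum_{n=1}^N d(f^{a_n}x,f^{a_n}z)<\epsilon$. $\mathrm{Basin}(K)$ is the set of all points $\mathbf a$-mean attracted to $K$. $f$ is $\mathbf a$-MMA if $X=\bigcup_K\mathrm{Basin}(K)$, the union being over all minimal subsets $K$. *)

(* Defs.v *)
(* MathComp-Analysis, over an arbitrary R : realType. *)
From HB Require Import structures.
From mathcomp Require Import all_boot all_order all_algebra.
From mathcomp Require Import all_classical all_reals all_analysis.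
From mathcomp Require Import complex.

Set Implicit Arguments.
Unset Strict Implicit.
Unset Printing Implicit Defensive.

Import Order.TTheory GRing.Theory Num.Theory.
Import numFieldNormedType.Exports.
Local Open Scope classical_set_scope.
Local Open Scope ring_scope.

Section Averages.

(* The averages start at n = 1, so that u 0 plays no role; the value at
   N = 0 is a junk 0, irrelevant to limits and upper limits. *)
Definition average (F : fieldType) (u : nat -> F) (N : nat) : F :=
  N%:R^-1 * \sum_(1 <= n < N.+1) u n.

Definition expi (R : realType) (t : R) : R[i] := (cos t +i* sin t)%C.

(* The regular module R[i]^o carries the topology of the modulus. *)
Definition uniformly_behaved (R : realType) (a : nat -> nat) : Prop :=
  forall theta : R, 0 < theta < 1 ->
    (average (fun n => expi (2 * pi * (a n)%:R * theta)) : nat -> R[i]^o)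
      @ \oo --> (0 : R[i]^o).

Definition upper_density (R : realType) (a : nat -> nat) (E : set nat) :
    \bar R :=
  limn_esup (fun N =>
    ((count (fun n => a n \in E) (index_iota 1 N.+1))%:R / N%:R)%:E).

End Averages.

Section Subspace.
Context (R : realType) (X : metricType R) (A : set X).

Let dist (x y : A) : R := mdist (\val x) (\val y).

Let dist_ge0 x y : 0 <= dist x y.
Proof. exact: mdist_ge0. Qed.

Let dist_positivity x y : dist x y = 0 -> x = y.
Proof. by move=> /mdist_positivity /val_inj. Qed.

Let ballEdist (x : A) e : ball x e = [set y | dist x y < e].
Proof. by rewrite -[LHS]/(\val @^-1` ball (\val x) e) ballEmdist. Qed.

HB.instance Definition _ := PseudoMetric_isMetric.Build R (set_type A)
  dist_ge0 dist_positivity ballEdist.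

End Subspace.

Definition mean_lyapunov_stable (R : realType) (Y : metricType R)
    (a : nat -> nat) (g : Y -> Y) : Prop :=
  forall eps : R, 0 < eps -> exists (delta : R) (E : set nat),
    [/\ 0 < delta, (upper_density R a E < eps%:E)%E &
      forall x y : Y, mdist x y < delta ->
        forall n : nat, (1 <= n)%N -> a n \notin E ->
          mdist (iter (a n) g x) (iter (a n) g y) < eps].

Definition borel (Y : ptopologicalType) := g_sigma_algebraType (@open Y).

Definition invariant_measure (R : realType) (Y : ptopologicalType)
    (g : Y -> Y) (mu : probability (borel Y) R) : Prop :=
  forall A : set (borel Y), measurable A -> mu (g @^-1` A) = mu A.

(* Measures are total functions on [set T] whose values outside the
   sigma-algebra are irrelevant, hence uniqueness on measurable sets only. *)
Definition uniquely_ergodic (R : realType) (Y : ptopologicalType)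
    (g : Y -> Y) : Prop :=
  exists2 nu : probability (borel Y) R, invariant_measure g nu &
    forall mu : probability (borel Y) R, invariant_measure g mu ->
      forall A : set (borel Y), measurable A -> mu A = nu A.

Section MinimalSubsets.
Context (R : realType) (X : metricType R) (f : X -> X).

Definition is_minimal (K : set X) : Prop :=
  [/\ K !=set0, closed K, f @` K `<=` K &
    forall x, K x -> K `<=` closure (range (fun n => iter n f x))].

Record minimal_subset := MinimalSubset {
  minimal_set :> set X;
  minimal_setP : is_minimal minimal_set }.

(* K as a metric space; its base point, which measurable types require, is
   chosen arbitrarily. *)
Definition minimal_space (K : minimal_subset) : Type := set_type K.

Lemma minimal_subset_neq0 (K : minimal_subset) : exists x, minimal_set K x.
Proof. by case: (minimal_setP K). Qed.

HB.instance Definition _ (K : minimal_subset) :=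
  Metric.copy (minimal_space K) (set_type K).
HB.instance Definition _ (K : minimal_subset) :=
  isPointed.Build (minimal_space K)
    (exist _ (projT1 (cid (minimal_subset_neq0 K)))
      (mem_set (projT2 (cid (minimal_subset_neq0 K))))).

Lemma restrict_subproof (K : minimal_subset) (x : minimal_space K) :
  f (\val x) \in minimal_set K.
Proof.
have [_ _ fK _] := minimal_setP K.
by apply/mem_set/fK; exists (\val x) => //; exact/set_mem/valP.
Qed.

Definition minimal_restrict (K : minimal_subset) (x : minimal_space K) :
    minimal_space K :=
  exist _ (f (\val x)) (restrict_subproof x).

End MinimalSubsets.

Arguments minimal_space {R X f} K.
Arguments minimal_restrict {R X f} K x.

Definition MUEMLS (R : realType) (X : metricType R) (a : nat -> nat)
    (f : X -> X) : Prop :=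
  forall K : minimal_subset f,
    uniquely_ergodic R (minimal_restrict K) /\
    mean_lyapunov_stable a (minimal_restrict K).

Definition basin (R : realType) (X : metricType R) (a : nat -> nat)
    (f : X -> X) (K : set X) : set X :=
  [set x | forall eps : R, 0 < eps -> exists2 z, K z &
    (limn_esup (fun N =>
       (average (fun n => mdist (iter (a n) f x) (iter (a n) f z)) N)%:E)
     < eps%:E)%E].

Definition MMA (R : realType) (X : metricType R) (a : nat -> nat)
    (f : X -> X) : Prop :=
  [set: X] = \bigcup_(K in is_minimal f) basin a f K.

Definition cintegral (R : realType) d (T : measurableType d)
    (mu : {measure set T -> \bar R}) (h : T -> R[i]) : R[i] :=
  ((\int[mu]_t complex.Re (h t)) +i* (\int[mu]_t complex.Im (h t)))%C.

(* Main.v *)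
Require Import Defs.
From HB Require Import structures.
From mathcomp Require Import all_boot all_order all_algebra.
From mathcomp Require Import all_classical all_reals all_analysis.
From mathcomp Require Import complex measurable_realfun.
From mathcomp Require Import ring lra zify.

Set Implicit Arguments.
Unset Strict Implicit.
Unset Printing Implicit Defensive.

Import Order.TTheory GRing.Theory Num.Theory.
Import numFieldNormedType.Exports.
Local Open Scope classical_set_scope.
Local Open Scope ring_scope.

(** Let [g] be the restriction of [f] to [K], let [nu] be its invariant
    probability, let [h] be a real continuous function on [K] of integral [0],
    and write [A_N y] for the average of [h (g^(a_n) y)] over [1 <= n <= N].
    The real and imaginary parts of [phi] are treated separately, so the heart
    of the matter is that [A_N z --> 0] for every point [z] of [K].

    Convergence in the mean.  The correlations [gam k], the integrals of
    [h * h \o g^k], form a positive definite sequence.  As in the theorem of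
    Herglotz they are the Fourier coefficients of a positive functional [Lam] on
    the continuous functions on [0, 1] ([herglotz]), which stands for the
    spectral measure of [h].  Expanding the square, the integral of [A_N ^+ 2]
    equals [Lam p_N] where
    [p_N theta = | average of exp (2 i pi a_n theta) | ^ 2].
    Uniform behaviour of [a] says that [p_N --> 0] pointwise on the open interval
    ]0, 1[.  Positive functionals obey bounded convergence for continuous
    functions ([pfun_cvg0]), so only the end points, the frequency [0], could
    obstruct [Lam p_N --> 0].  They carry no mass ([quadratic_average_cvg0]): the
    same quantity computed along the sequence [a_n = n] is the integral of the
    square of a Birkhoff average, which tends to [0] because [nu], being the only
    invariant probability, is ergodic ([uniquely_ergodic_ergodic]), by the maximal
    ergodic inequality ([maximal_ergodic], [birkhoff_ae_cvg0]).  This gives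
    [ergodic_mean_cvg0].

    From the mean to points of [K].  Mean Lyapunov stability makes the averages
    [A_N] almost constant on small balls, uniformly for large [N]
    ([mean_lyapunov_stable_average]), and [nu] charges every ball because every
    orbit in [K] is dense ([invariant_measure_full_support]).  An average that
    stayed away from [0] at [z] would therefore keep a positive mean square
    ([minimal_average_cvg]).

    From [K] to its basin.  On a compact space a continuous function is Lipschitz
    up to an arbitrarily small constant ([compact_almost_lipschitz]), so points
    whose orbits are close on average along [a] have close averages
    ([basin_average_cvg]). *)

(** * Averages *)

Section Averages.
Context (R : realType).
Implicit Types u v : nat -> R.

Lemma ler_average u v N : (forall n, (1 <= n)%N -> u n <= v n) ->
  average u N <= average v N.
Proof.
move=> uv; rewrite ler_wpM2l ?invr_ge0// !big_nat.
by apply: ler_sum => n /andP[/uv].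
Qed.

Lemma averageD u v N :
  average (fun n => u n + v n) N = average u N + average v N.
Proof. by rewrite /average big_split mulrDr. Qed.

Lemma averageZ c u N : average (fun n => c * u n) N = c * average u N.
Proof. by rewrite /average -mulr_sumr mulrCA. Qed.

Lemma averageB u v N :
  average (fun n => u n - v n) N = average u N - average v N.
Proof. by rewrite /average sumrB mulrBr. Qed.

Lemma average_cst (c : R) N : (0 < N)%N -> average (fun=> c) N = c.
Proof.
move=> N0; rewrite /average sumr_const_nat subSS subn0 -(mulr_natl c) mulrA.
by rewrite mulVf ?mul1r// pnatr_eq0 -lt0n.
Qed.

Lemma ler_norm_average u N : `|average u N| <= average (fun n => `|u n|) N.
Proof.
by rewrite /average normrM ger0_norm ?invr_ge0// ler_wpM2l ?invr_ge0// ler_norm_sum.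
Qed.

Lemma average_count (p : pred nat) N :
  average (fun n => (p n)%:R : R) N = (count p (index_iota 1 N.+1))%:R / N%:R.
Proof.
rewrite /average -natr_sum mulrC; congr (_%:R / _).
by rewrite -sum1_count [RHS]big_mkcond; apply: eq_bigr => n _; case: (p n).
Qed.

End Averages.

(** * Positive functionals and bounded convergence *)

Definition bounded_seq (R : realType) (u : nat -> R) : Prop :=
  exists C : R, forall n, `|u n| <= C.

Lemma ultra_limit (R : realType) (U : set_system nat) (u : nat -> R) :
  UltraFilter U -> bounded_seq u -> exists l : R, u @ U --> l.
Proof.
move=> UU [C uC].
have uU : UltraFilter (u @ U).
  split => [|G GG sUG]; first exact: fmap_proper_filter.
  apply/seteqP; split=> // A GA.
  have [//|UnA] := in_ultra_setVsetC (u @^-1` A) UU.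
  have GnA : G (~` A) by apply: sUG.
  by have /filter_ex[x []] := @filterI _ _ GG _ _ GA GnA.
have uI : (u @ U) [set` `[- C, C]].
  by apply: (@filterE _ U) => n; rewrite /= in_itv /= -ler_norml.
have := @segment_compact R (- C) C; rewrite compact_ultra.
by move=> /(_ _ uU uI)[l [_ ul]]; exists l.
Qed.

(** A limit along an ultrafilter: it serves to pass to the limit in a sequence of
    functionals at all continuous functions at once, with neither separability
    nor extraction of subsequences. *)
Lemma generalized_limit (R : realType) :
  exists L : (nat -> R) -> R,
  [/\ forall u l, u @ \oo --> l -> L u = l,
      forall u v, bounded_seq u -> bounded_seq v ->
        L (fun n => u n + v n) = L u + L v,
      forall c u, bounded_seq u -> L (fun n => c * u n) = c * L u &
      forall u v, bounded_seq u -> bounded_seq v -> (forall n, u n <= v n) ->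
        L u <= L v].
Proof.
have [U [UU ooU]] := @ultraFilterLemma nat \oo _.
have PU : ProperFilter U by exact: ultra_proper.
have limE (u : nat -> R) (l : R) : u @ U --> l -> lim (u @ U) = l.
  exact: cvg_lim.
have limP (u : nat -> R) : bounded_seq u -> u @ U --> lim (u @ U).
  by move=> /(ultra_limit UU)[l ul]; rewrite (limE _ _ ul).
exists (fun u => lim (u @ U)); split.
- by move=> u l ul; apply: limE; apply: cvg_trans ul; exact: cvg_app.
- by move=> u v /limP bu /limP bv; apply: limE; exact: cvgD.
- by move=> c u /limP bu; apply: limE; apply: cvgMr.
- move=> u v /limP bu /limP bv uv.
  by apply: ler_cvg_to bu bv _; exact: nearW.
Qed.

(** Only the values on continuous functions matter, and positivity is relative to
    the set [D] that carries the functional; with compact [D] these are the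
    finite measures on [D], handled without measure theory. *)
Record positive_functional (R : realType) (T : topologicalType) (D : set T)
    (Lam : (T -> R) -> R) : Prop := PositiveFunctional {
  pfunD : forall F G : T -> R, continuous F -> continuous G ->
    Lam (fun x => F x + G x) = Lam F + Lam G ;
  pfunZ : forall (c : R) (F : T -> R), continuous F ->
    Lam (fun x => c * F x) = c * Lam F ;
  pfun_le : forall F G : T -> R, continuous F -> continuous G ->
    (forall x, D x -> F x <= G x) -> Lam F <= Lam G }.

(** Compactness turns the local estimate into a uniform one: if [r n x < eps],
    then by continuity and monotonicity [r m y < eps] for all [m >= n] and all
    [y] near [x]. *)
Lemma dini (R : realType) (T : topologicalType) (D : set T)
    (r : nat -> T -> R) (eps : R) :
  compact D -> (forall n, continuous (r n)) ->
  (forall n x, r n.+1 x <= r n x) ->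
  (forall x, D x -> exists n, r n x < eps) ->
  exists n, forall x, D x -> r n x < eps.
Proof.
move=> cD cr decr r0.
have mono m n x : (m <= n)%N -> r n x <= r m x.
  move=> /subnK <-; elim: (n - m)%N => [//|k IH].
  by rewrite addSn (le_trans (decr _ _)).
move: cD => /compact_near_coveringP /(_ nat \oo (fun n x => r n x < eps) _) H.
have [n _ /(_ n (leqnn n)) nH] : \forall n \near \oo, D `<=` (fun x => r n x < eps).
  apply: H => x /r0 [n rn].
  exists ([set y | r n y < eps], [set m | (n <= m)%N]).
    split; last by exists n.
    exact: (@cr n x _ (lt_nbhsl rn)).
  by move=> [y m] [/= ry nm]; apply: le_lt_trans ry; exact: mono.
by exists n => x /nH.
Qed.

Lemma continuous_bigmax (R : realType) (T : topologicalType)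
    (p : nat -> T -> R) (k m : nat) : (forall n, continuous (p n)) ->
  continuous (fun x => \big[Num.max/0]_(k <= n < m) p n x).
Proof.
move=> cp; rewrite /index_iota; elim: (iota k (m - k)) => [|n s IH].
  under eq_fun do rewrite big_nil.
  by move=> x; exact: cvg_cst.
under eq_fun do rewrite big_cons.
by move=> x; apply: continuous_max; [exact: cp|exact: IH].
Qed.

Lemma continuous_bigsum (R : realType) (T : topologicalType) (I : Type)
    (s : seq I) (F : I -> T -> R) : (forall i, continuous (F i)) ->
  continuous (fun x => \sum_(i <- s) F i x).
Proof.
move=> cF; elim: s => [|i s IH].
  by under eq_fun do rewrite big_nil; move=> x; exact: cvg_cst.
under eq_fun do rewrite big_cons.
by move=> x; apply: cvgD; [exact: cF|exact: IH].
Qed.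

Lemma pfun_cst (R : realType) (T : topologicalType) (D : set T)
    (Lam : (T -> R) -> R) (c : R) : positive_functional D Lam ->
  Lam (fun=> c) = c * Lam (fun=> 1).
Proof.
move=> pL; rewrite -(pfunZ pL); last by move=> x; exact: cvg_cst.
by under [in RHS]eq_fun do rewrite mulr1.
Qed.

Lemma pfun_ge0 (R : realType) (T : topologicalType) (D : set T)
    (Lam : (T -> R) -> R) (F : T -> R) : positive_functional D Lam ->
  continuous F -> (forall x, D x -> 0 <= F x) -> 0 <= Lam F.
Proof.
move=> pL cF F0; have := pfun_cst 0 pL; rewrite mul0r => <-.
by apply: (pfun_le pL) => // x; exact: cvg_cst.
Qed.

(** Were [Lam (p n) >= c > 0] infinitely often, the suprema of the tails of [p]
    would have functional at least [c] while decreasing to [0] pointwise.  They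
    are not continuous, so Dini does not apply to them.  Instead, the k-th tail
    supremum is replaced by a finite maximum [q k (M k)] that realises its
    functional up to [e k], and these by their running minima [r k].  The errors
    [e k] form a convergent geometric series, so [Lam (r k) >= c / 2]; but the
    [r k] are continuous and decrease to [0], hence uniformly on [D]. *)
Theorem pfun_cvg0 (R : realType) (T : topologicalType) (D : set T)
    (Lam : (T -> R) -> R) (p : nat -> T -> R) :
  compact D -> positive_functional D Lam ->
  (forall n, continuous (p n)) ->
  (forall n x, D x -> 0 <= p n x <= 1) ->
  (forall x, D x -> p ^~ x @ \oo --> 0) ->
  (fun n => Lam (p n)) @ \oo --> 0.
Proof.
move=> cD pL cp p01 p0.
have Lp0 n : 0 <= Lam (p n).
  by apply: (pfun_ge0 pL (cp n)) => x /p01 - /(_ n) /andP[].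
apply: contrapT => nLp.
have [c c0 Lpc] : exists2 c : R, 0 < c & forall k, exists2 n, (k <= n)%N & c <= Lam (p n).
  apply: contrapT => nc; apply: nLp; apply/cvgrPdist_lt => e e0.
  have [k kP] : exists k, forall n, (k <= n)%N -> Lam (p n) < e.
    apply: contrapT => nk; apply: nc; exists e => // k.
    apply: contrapT => nkn; apply: nk; exists k => n kn.
    by rewrite ltNge; apply/negP => en; apply: nkn; exists n.
  by exists k => // n /= /kP; rewrite sub0r normrN ger0_norm.
pose q k m x := \big[Num.max/0]_(k <= n < m) p n x.
have cq k m : continuous (q k m) by exact: continuous_bigmax.
have q_mono k k' m m' x : (k' <= k)%N -> (m <= m')%N -> q k m x <= q k' m' x.
  by move=> kk mm; exact: le_bigmax_nat.
have pq k m n x : (k <= n < m)%N -> p n x <= q k m x.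
  by move=> knm; apply: le_bigmax_seq; rewrite ?mem_index_iota.
have cmax (F G : T -> R) : continuous F -> continuous G ->
    continuous (fun x => Num.max (F x) (G x)).
  by move=> cF cG x; apply: continuous_max; [exact: cF|exact: cG].
have cmin (F G : T -> R) : continuous F -> continuous G ->
    continuous (fun x => Num.min (F x) (G x)).
  by move=> cF cG x; apply: continuous_min; [exact: cF|exact: cG].
pose e k : R := c / 4 * 2^-1 ^+ k.
have e_gt0 k : 0 < e k by rewrite mulr_gt0 ?exprn_gt0 ?divr_gt0 ?invr_gt0.
have Lq1 k m : Lam (q k m) <= Lam (fun=> 1).
  apply: (pfun_le pL) => //; first by move=> x; exact: cvg_cst.
  by move=> x Dx; apply: bigmax_le => // n _; have /andP[] := p01 n x Dx.
have /choice[M MP] k : exists m, [/\ c <= Lam (q k m) &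
    forall m', Lam (q k m') <= Lam (q k m) + e k].
  pose S := range (fun m => Lam (q k m)).
  have supS : has_sup S.
    split; first by exists (Lam (q k 0)), 0%N.
    by exists (Lam (fun=> 1)) => _ [m _ <-].
  have [_ [m1 _ <-] m1P] := sup_adherent (e_gt0 k) supS.
  have [n kn cn] := Lpc k.
  exists (maxn m1 n.+1); split.
    apply: le_trans cn _; apply: (pfun_le pL) => // x _.
    by apply: pq; rewrite kn leq_maxr.
  move=> m'; have : Lam (q k m') <= sup S.
    by apply: ub_le_sup; [case: supS|exists m'].
  have : Lam (q k m1) <= Lam (q k (maxn m1 n.+1)).
    by apply: (pfun_le pL) => // x _; apply: q_mono => //; rewrite leq_maxl.
  move: m1P; lra.
pose r := fix r k := if k is k'.+1 then fun x => Num.min (r k' x) (q k (M k) x)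
  else q 0%N (M 0%N).
have cr k : continuous (r k) by elim: k => [|k IH]; [exact: cq|exact: cmin].
(* The errors up to rank k add up to c / 4 + ... + c / (4 * 2 ^ k), which is
   c / 2 - e k; the lattice identity min + max = sum propagates the bound. *)
have r_key k m : Lam (fun x => Num.max (r k x) (q k m x)) <= Lam (r k) + (c / 2 - e k).
  elim: k m => [|k IH] m.
    have -> : (c / 2 - e 0%N) = e 0%N by rewrite /e expr0; lra.
    apply: le_trans ((MP 0%N).2 (maxn (M 0%N) m)).
    apply: (pfun_le pL) => // [|x _]; first exact: cmax.
    by rewrite ge_max !q_mono ?leq_maxl ?leq_maxr.
  have step1 : Lam (fun x => Num.max (r k.+1 x) (q k.+1 m x)) <=
      Lam (q k.+1 (maxn (M k.+1) m)).
    apply: (pfun_le pL) => // [|x _]; first exact: cmax.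
    rewrite ge_max [leLHS]/= ge_min !q_mono ?leq_maxl ?leq_maxr ?orbT//.
  have step2 := (MP k.+1).2 (maxn (M k.+1) m).
  have step3 : Lam (r k.+1) + Lam (fun x => Num.max (r k x) (q k.+1 (M k.+1) x)) =
      Lam (r k) + Lam (q k.+1 (M k.+1)).
    rewrite -!(pfunD pL) //; last exact: cmax.
    by congr (Lam _); apply/funext => x /=; rewrite addr_min_max.
  have step4 : Lam (fun x => Num.max (r k x) (q k.+1 (M k.+1) x)) <=
      Lam (fun x => Num.max (r k x) (q k (M k.+1) x)).
    apply: (pfun_le pL) => // [||x _]; [exact: cmax|exact: cmax|].
    by rewrite ge_max !le_max lexx q_mono ?orbT.
  have := IH (M k.+1).
  have : e k.+1 = e k / 2 by rewrite /e exprSr mulrA.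
  lra.
have Lr k : c / 2 <= Lam (r k).
  have := r_key k (M k); have := (MP k).1; have := e_gt0 k.
  have : Lam (q k (M k)) <= Lam (fun x => Num.max (r k x) (q k (M k) x)).
    apply: (pfun_le pL) => // [|x _]; first exact: cmax.
    by rewrite le_max lexx orbT.
  lra.
have L1 : 0 <= Lam (fun=> 1).
  by apply: (pfun_ge0 pL) => //; move=> x; exact: cvg_cst.
pose eta := c / 4 / (Lam (fun=> 1) + 1).
have eta0 : 0 < eta by rewrite !divr_gt0// ltr_wpDl.
have [] := @dini R T D r eta cD cr.
- by move=> n x /=; rewrite ge_min lexx.
- move=> x Dx; have /cvgrPdist_lt /(_ _ (divr_gt0 eta0 (ltr0n _ 2))) := p0 x Dx.
  move=> [k _ kP]; exists k.
  have rq : r k x <= q k (M k) x.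
    by case: (k) => [//|j] /=; rewrite ge_min lexx orbT.
  apply: le_lt_trans rq _; apply: (@le_lt_trans _ _ (eta / 2)); last lra.
  rewrite /q big_seq; apply: bigmax_le; first lra.
  move=> n; rewrite mem_index_iota => /andP[kn _].
  have := kP n kn; rewrite sub0r normrN => /ltW; apply: le_trans; exact: ler_norm.
- move=> n rn; have : Lam (r n) <= eta * Lam (fun=> 1).
    rewrite -(pfun_cst _ pL); apply: (pfun_le pL) => //.
      by move=> x; exact: cvg_cst.
    by move=> x /rn /ltW.
  have : eta * (Lam (fun=> 1) + 1) = c / 4.
    by rewrite /eta divfK// gt_eqF// ltr_wpDl.
  by have := Lr n; lra.
Qed.

Lemma compact_continuous_bounded (R : realType) (T : topologicalType) (D : set T)
    (F : T -> R) :
  compact D -> continuous F -> exists2 B : R, 0 <= B & forall x, D x -> `|F x| <= B.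
Proof.
move=> cD cF.
have /compact_bounded[B0 [_ /(_ (Num.max 1 (B0 + 1)))]] : compact (F @` D).
  by apply: continuous_compact => //; exact: continuous_subspaceT.
rewrite lt_max ltrDl ltr01 orbT => /(_ isT) H.
exists (Num.max 1 (B0 + 1)); first by rewrite le_max ler01.
by move=> x Dx; apply: H; exists x.
Qed.

(** Weak compactness of a set of positive functionals of bounded mass. *)
Lemma pfun_compactness (R : realType) (T : topologicalType) (D : set T)
    (Lam : nat -> (T -> R) -> R) (C : R) :
  compact D -> (forall M, positive_functional D (Lam M)) ->
  (forall M, Lam M (fun=> 1) <= C) ->
  exists2 L : (T -> R) -> R, positive_functional D L &
    forall (F : T -> R) (l : R), continuous F ->
      (fun M => Lam M F) @ \oo --> l -> L F = l.
Proof.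
move=> cD pL LC; have [G [Glim GD GZ Gle]] := generalized_limit R.
have bL (F : T -> R) : continuous F -> bounded_seq (fun M => Lam M F).
  move=> cF.
  have [B B0 FB] := compact_continuous_bounded cD cF.
  exists (B * C) => M; have FBx x : D x -> - B <= F x <= B.
    by move=> /FB; rewrite ler_norml.
  have LB (b : R) : Lam M (fun=> b) = b * Lam M (fun=> 1) by exact: pfun_cst.
  have cc (b : R) : continuous (fun _ : T => b) by move=> x; exact: cvg_cst.
  have hi : Lam M F <= Lam M (fun=> B).
    by apply: (pfun_le (pL M)) => // x /FBx /andP[].
  have lo : Lam M (fun=> - B) <= Lam M F.
    by apply: (pfun_le (pL M)) => // x /FBx /andP[].
  have BC := ler_wpM2l B0 (LC M).
  move: hi lo; rewrite (LB B) (LB (- B)) mulNr ler_norml => hi lo.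
  by rewrite (le_trans _ lo) ?lerN2//= (le_trans hi).
exists (fun F => G (fun M => Lam M F)); last by move=> F l _; exact: Glim.
split.
- move=> F1 F2 c1F c2F; rewrite -GD; [|exact: bL|exact: bL].
  by congr G; apply/funext => M; rewrite (pfunD (pL M)).
- move=> c F cF; rewrite -GZ; last exact: bL.
  by congr G; apply/funext => M; rewrite (pfunZ (pL M)).
- move=> F1 F2 cF1 cF2 F12; apply: Gle; [exact: bL|exact: bL|move=> M].
  exact: (pfun_le (pL M)).
Qed.

(** * Spectral functional of a positive definite sequence *)

(** Orthogonality of the characters of the cyclic group of order [L].  The sum
    telescopes after multiplication by [sin (pi i / L)]. *)
Lemma sum_cos_root (R : realType) (L : nat) (i : int) : (`|i| < L)%N ->
  \sum_(0 <= t < L) cos (2 * pi * i%:~R * (t%:R / L%:R)) =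
  (if i == 0 then L%:R else 0) :> R.
Proof.
move=> iL; have [->|i0] := eqVneq i 0.
  under eq_bigr do rewrite mulr0 mul0r cos0.
  by rewrite sumr_const_nat subn0.
have L0 : (L%:R : R) != 0 by rewrite pnatr_eq0 -lt0n (leq_ltn_trans _ iL).
wlog : i i0 iL / 0 <= i.
  move=> H; have [/H|/ltW i0'] := leP 0 i; first exact.
  rewrite -[RHS](H (- i)) ?oppr_eq0 ?abszN ?oppr_ge0//.
  by apply: eq_bigr => t _; rewrite mulrNz mulrN mulNr cosN.
case: i i0 iL => // n n0 nL _; rewrite absz_nat in nL.
have {}n0 : (0 < n)%N by rewrite lt0n.
set x : R := pi * n%:R / L%:R.
have sx : sin x != 0.
  rewrite gt_eqF// sin_gt0_pi//.
  rewrite divr_gt0 ?mulr_gt0 ?pi_gt0 ?ltr0n ?(ltn_trans n0 nL)//=.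
  rewrite ltr_pdivrMr ?ltr0n ?(ltn_trans n0 nL)//.
  by rewrite ltr_pM2l ?pi_gt0// ltr_nat.
apply: (mulfI sx); rewrite mulr0 mulr_sumr.
have E t : sin x * cos (2 * pi * n%:~R * (t%:R / L%:R)) =
    sin ((2 * t.+1%:R - 1) * x) / 2 - sin ((2 * t%:R - 1) * x) / 2.
  have -> : (2 * t.+1%:R - 1) * x = 2 * t%:R * x + x by rewrite -natr1; ring.
  have -> : (2 * t%:R - 1) * x = 2 * t%:R * x - x by ring.
  rewrite sinD sinB.
  have -> : 2 * pi * n%:~R * (t%:R / L%:R) = 2 * t%:R * x.
    by rewrite /x -[n%:~R]/(n%:R); ring.
  by field.
under eq_bigr do rewrite E.
rewrite telescope_sumr//.
have -> : (2 * L%:R - 1) * x = - x + (pi *+ 2) *+ n.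
  by rewrite /x -mulrnA -(mulr_natr pi); rewrite natrM; field.
rewrite (periodicn (@sinD2pi R)) mulr0 sub0r mulN1r; ring.
Qed.

(** Real even positive definite functions on the integers, encoded by their values
    on natural numbers. *)
Definition positive_definite (R : realType) (gam : nat -> R) : Prop :=
  forall (c : nat -> R) (M : nat),
    0 <= \sum_(0 <= k < M) \sum_(0 <= l < M) c k * c l * gam `|k%:Z - l%:Z|%N.

(** For the correlations of [h] under [g] this is the mean square of
    [M ^ (- 1/2) * sum of exp (2 i pi k theta) h \o g^k], [k < M]. *)
Definition fejer (R : realType) (gam : nat -> R) (M : nat) (theta : R) : R :=
  M%:R^-1 * \sum_(0 <= k < M) \sum_(0 <= l < M)
    cos (2 * pi * (k%:Z - l%:Z)%:~R * theta) * gam `|k%:Z - l%:Z|%N.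

(** Integration against the Fejer density, with the integral over the circle
    replaced by a sum over the roots of unity of order [2 * M], which is exact for
    the frequencies below [2 * M] that occur. *)
Definition fejer_functional (R : realType) (gam : nat -> R) (M : nat)
    (F : R -> R) : R :=
  (2 * M)%:R^-1 * \sum_(0 <= t < 2 * M)
    F (t%:R / (2 * M)%:R) * fejer gam M (t%:R / (2 * M)%:R).

(** The cosine of a difference is a sum of two products, so the density is a sum of
    two values of the positive definite form, at cosines and at sines. *)
Lemma fejer_ge0 (R : realType) (gam : nat -> R) (M : nat) (theta : R) :
  positive_definite gam -> 0 <= fejer gam M theta.
Proof.
move=> pd; rewrite mulr_ge0 ?invr_ge0//.
have := addr_ge0 (pd (fun k => cos (2 * pi * k%:R * theta)) M)
                 (pd (fun k => sin (2 * pi * k%:R * theta)) M).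
rewrite -big_split/=; congr (0 <= _); apply: eq_bigr => k _.
rewrite -big_split/=; apply: eq_bigr => l _.
rewrite -mulrDl rmorphB /= -![_%:~R]/(_%:R) mulrBr mulrBl.
by rewrite cosB.
Qed.

Lemma fejer_functional_positive (R : realType) (gam : nat -> R) (M : nat) :
  positive_definite gam ->
  positive_functional (`[0, 1]%classic : set R) (fejer_functional gam M).
Proof.
move=> pd; split.
- move=> F G _ _; rewrite -mulrDr -big_split; congr (_ * _).
  by apply: eq_bigr => t _; rewrite mulrDl.
- move=> c F _; rewrite mulrCA mulr_sumr; congr (_ * _).
  by apply: eq_bigr => t _; rewrite -mulrA.
- move=> F G _ _ FG; rewrite ler_wpM2l ?invr_ge0// !big_nat.
  apply: ler_sum => t /andP[_ tM]; rewrite ler_wpM2r ?fejer_ge0//.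
  apply: FG; rewrite /= in_itv /= divr_ge0//=.
  by rewrite ler_pdivrMr ?mul1r ?ler_nat ?ltr0n ?(leq_ltn_trans _ tM)// ltnW.
Qed.

(** Orthogonality leaves the pairs [(k, l)] with [l = k + j] or [k = l + j];
    there are [M - j] of each kind. *)
Lemma fejer_functional_cos (R : realType) (gam : nat -> R) (M j : nat) :
  (j <= M)%N -> (0 < M)%N ->
  fejer_functional gam M (fun theta => cos (2 * pi * j%:R * theta)) =
  (M - j)%:R / M%:R * gam j.
Proof.
move=> jM M0.
have cos_prod (k l : nat) : (k < M)%N -> (l < M)%N ->
    \sum_(0 <= t < 2 * M) cos (2 * pi * j%:R * (t%:R / (2 * M)%:R)) *
      cos (2 * pi * (k%:Z - l%:Z)%:~R * (t%:R / (2 * M)%:R)) =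
    M%:R * ((l == k + j)%N%:R + (k == l + j)%N%:R) :> R.
  move=> kM lM; pose s (i : int) : R := if i == 0 then (2 * M)%:R else 0.
  transitivity (2^-1 * (s (j%:Z + k%:Z - l%:Z) + s (j%:Z - k%:Z + l%:Z))).
    rewrite /s -!sum_cos_root; [|lia|lia].
    rewrite -big_split /= mulr_sumr; apply: eq_bigr => t _.
    have E (i : R) : 2 * pi * i * (t%:R / (2 * M)%:R) =
      2 * pi * (t%:R / (2 * M)%:R) * i by ring.
    have -> : (j%:Z + k%:Z - l%:Z)%:~R = j%:R + (k%:Z - l%:Z)%:~R :> R.
      by rewrite -addrA rmorphD.
    have -> : (j%:Z - k%:Z + l%:Z)%:~R = j%:R - (k%:Z - l%:Z)%:~R :> R.
      by rewrite -addrA rmorphD -rmorphN /= opprB [- _ + _]addrC.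
    rewrite !E !mulrDr !mulrN !cosD cosN sinN; lra.
  have sE (i : int) (b : bool) : (i == 0) = b -> s i = (2 * M)%:R * b%:R.
    by rewrite /s => ->; case: b; rewrite ?mulr1 ?mulr0.
  rewrite (sE _ (l == k + j)%N) ?(sE _ (k == l + j)%N); [|lia|lia].
  by rewrite natrM; field.
pose G (k l : nat) : R := gam `|k%:Z - l%:Z|%N * (l == k + j)%N%:R.
have GE : \sum_(0 <= k < M) \sum_(0 <= l < M) G k l = (M - j)%:R * gam j.
  transitivity (\sum_(0 <= k < M) (if (k < M - j)%N then gam j else 0)).
    rewrite [in LHS]big_nat [RHS]big_nat; apply: eq_bigr => k /andP[_ kM].
    case: ifPn => [kMj|kMj].
      rewrite (bigD1_seq (k + j)%N) ?iota_uniq ?mem_index_iota//=; last lia.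
      rewrite /G eqxx mulr1 big1 ?addr0; first by congr gam; lia.
      by move=> l /negbTE ->; rewrite mulr0.
    rewrite big_nat big1// => l lM; rewrite /G.
    have /negbTE -> : (l != k + j)%N by lia.
    by rewrite mulr0.
  rewrite -big_mkcond /= -(big_nat_widen 0 (M - j) M xpredT) ?leq_subr//.
  by rewrite sumr_const_nat subn0 mulr_natl.
have M2 : (2 * M)%:R != 0 :> R by rewrite pnatr_eq0; lia.
have M1 : M%:R != 0 :> R by rewrite pnatr_eq0; lia.
rewrite /fejer_functional.
transitivity ((2 * M)%:R^-1 * (M%:R^-1 * \sum_(0 <= k < M) \sum_(0 <= l < M)
   (M%:R * (G k l + G l k)))).
  congr (_ * _); rewrite /fejer.
  under eq_bigr do rewrite mulrCA; rewrite -mulr_sumr; congr (_ * _).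
  under eq_bigr do rewrite mulr_sumr.
  rewrite exchange_big /= !big_nat; apply: eq_bigr => k /andP[_ kM].
  under eq_bigr do rewrite mulr_sumr.
  rewrite exchange_big /= !big_nat; apply: eq_bigr => l /andP[_ lM].
  under eq_bigr do rewrite mulrA.
  rewrite -mulr_suml cos_prod// /G.
  have -> : `|l%:Z - k%:Z|%N = `|k%:Z - l%:Z|%N by rewrite distnC.
  ring.
have -> : \sum_(0 <= k < M) \sum_(0 <= l < M) (M%:R * (G k l + G l k)) =
    M%:R * (2 * ((M - j)%:R * gam j)).
  under eq_bigr do rewrite -mulr_sumr.
  rewrite -mulr_sumr; congr (_ * _).
  under eq_bigr do rewrite big_split/=.
  rewrite big_split /= [X in _ + X]exchange_big /= GE; ring.
by rewrite natrM; field.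
Qed.

Lemma continuous_cosM (R : realType) (c : R) : continuous (fun theta => cos (c * theta)).
Proof.
by move=> x; apply: continuous_comp; [exact: mulrl_continuous|exact: continuous_cos].
Qed.

(** A limit point of the Fejer functionals; the mass is constantly [gam 0]. *)
Theorem herglotz (R : realType) (gam : nat -> R) : positive_definite gam ->
  exists2 Lam : (R -> R) -> R,
    positive_functional (`[0, 1]%classic : set R) Lam &
    forall j, Lam (fun theta => cos (2 * pi * j%:R * theta)) = gam j.
Proof.
move=> pd.
have [||Lam pL LamE] := @pfun_compactness R R (`[0, 1]%classic : set R)
    (fun M => fejer_functional gam M.+1) (gam 0%N) (@segment_compact R 0 1).
- by move=> M; exact: fejer_functional_positive.
- move=> M; have := @fejer_functional_cos R gam M.+1 0 (leq0n _) (ltn0Sn _).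
  rewrite subn0 divff ?mul1r ?pnatr_eq0// => <-.
  by under [X in _ <= fejer_functional _ _ X]eq_fun do rewrite mulr0 mul0r cos0.
exists Lam => // j; apply: LamE; first exact: continuous_cosM.
apply: (@cvg_trans _ ((fun M => (1 - j%:R * harmonic M) * gam j) @ \oo)).
  apply: near_eq_cvg; exists j => // M /= jM.
  rewrite fejer_functional_cos ?(leq_trans jM)// natrB ?(leq_trans jM)//.
  by congr (_ * _); rewrite mulrBl divff ?pnatr_eq0.
have : (fun M => (1 - j%:R * harmonic M) * gam j) @ \oo --> (1 - j%:R * 0) * gam j.
  by apply: cvgMl; apply: cvgB; [exact: cvg_cst|apply: cvgMr; exact: cvg_harmonic].
by rewrite mulr0 subr0 mul1r.
Qed.

Lemma pfun_sum (R : realType) (T : topologicalType) (D : set T)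
    (Lam : (T -> R) -> R) (I : Type) (s : seq I) (F : I -> T -> R) :
  positive_functional D Lam -> (forall i, continuous (F i)) ->
  Lam (fun x => \sum_(i <- s) F i x) = \sum_(i <- s) Lam (F i).
Proof.
move=> pL cF; elim: s => [|i s IH].
  under [in LHS]eq_fun do rewrite big_nil.
  by rewrite big_nil (pfun_cst 0 pL) mul0r.
under [in LHS]eq_fun do rewrite big_cons.
rewrite big_cons -IH (pfunD pL)//; exact: continuous_bigsum.
Qed.

Definition quadratic_average (R : realType) (gam : nat -> R) (b : nat -> nat)
    (N : nat) : R :=
  average (fun m => average (fun n => gam `|(b m)%:Z - (b n)%:Z|%N) N) N.

(** The squared modulus of the average of [exp (2 i pi b_n theta)]. *)
Definition exp_average2 (R : realType) (b : nat -> nat) (N : nat) (theta : R) : R :=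
  average (fun n => cos (2 * pi * (b n)%:R * theta)) N ^+ 2 +
  average (fun n => sin (2 * pi * (b n)%:R * theta)) N ^+ 2.

Lemma exp_average2E (R : realType) (b : nat -> nat) (N : nat) (theta : R) :
  exp_average2 b N theta =
  quadratic_average (fun j => cos (2 * pi * j%:R * theta)) b N.
Proof.
rewrite /exp_average2 /quadratic_average /average !exprMn -mulrDr expr2 -mulrA.
congr (_ * _); rewrite !expr2 !mulr_suml -big_split /= mulr_sumr; apply: eq_bigr => m _.
rewrite !mulr_sumr -big_split/= mulr_sumr; apply: eq_bigr => n _; congr (_ * _).
have -> : cos (2 * pi * `|(b m)%:Z - (b n)%:Z|%N%:R * theta) =
    cos (2 * pi * ((b m)%:R - (b n)%:R) * theta) :> R.
  have [mn|nm] := leP (b m) (b n).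
    have -> : `|(b m)%:Z - (b n)%:Z|%N = (b n - b m)%N by lia.
    by rewrite natrB// -cosN; congr cos; ring.
  have -> : `|(b m)%:Z - (b n)%:Z|%N = (b m - b n)%N by lia.
  by rewrite natrB// ltnW.
by rewrite mulrBr mulrBl cosB.
Qed.

Lemma exp_average2_le1 (R : realType) (b : nat -> nat) (N : nat) (theta : R) :
  exp_average2 b N theta <= 1.
Proof.
case: N => [|N]; first by rewrite /exp_average2 /average invr0 !mul0r expr0n addr0.
have avg_le1 (u : nat -> R) : (forall n, u n <= 1) -> average u N.+1 <= 1.
  by move=> u1; rewrite -[leRHS](@average_cst R 1 N.+1)//; apply: ler_average => n _.
rewrite exp_average2E; apply: (avg_le1) => m; apply: (avg_le1) => n.
exact: cos_le1.
Qed.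

Lemma exp_average2_ge0 (R : realType) (b : nat -> nat) (N : nat) (theta : R) :
  0 <= exp_average2 b N theta.
Proof. by rewrite addr_ge0// sqr_ge0. Qed.

Lemma continuous_exp_average2 (R : realType) (b : nat -> nat) (N : nat) :
  continuous (exp_average2 b N : R -> R).
Proof.
have cavg (F : nat -> R -> R) : (forall n, continuous (F n)) ->
    continuous (fun x => average (fun n => F n x) N).
  by move=> cF x; apply: cvgMr; exact: continuous_bigsum.
have -> : exp_average2 b N =
    fun theta : R => quadratic_average (fun j => cos (2 * pi * j%:R * theta)) b N.
  by apply/funext => theta; exact: exp_average2E.
by apply: (cavg) => m; apply: (cavg) => n; exact: continuous_cosM.
Qed.

Lemma pfun_exp_average2 (R : realType) (Lam : (R -> R) -> R) (gam : nat -> R)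
    (b : nat -> nat) (N : nat) :
  positive_functional (`[0, 1]%classic : set R) Lam ->
  (forall j, Lam (fun theta => cos (2 * pi * j%:R * theta)) = gam j) ->
  Lam (exp_average2 b N) = quadratic_average gam b N.
Proof.
move=> pL LamE.
pose C (j : nat) (theta : R) := cos (2 * pi * j%:R * theta).
pose d m n := `|(b m)%:Z - (b n)%:Z|%N.
transitivity (Lam (fun theta => (N%:R^-1 ^+ 2) *
    \sum_(p <- [seq (m, n) | m <- index_iota 1 N.+1, n <- index_iota 1 N.+1])
      C (d p.1 p.2) theta)).
  congr Lam; apply/funext => theta; rewrite exp_average2E.
  rewrite big_allpairs /= expr2 -mulrA mulr_sumr.
  by congr (_ * _); apply: eq_bigr => m _.
rewrite (pfunZ pL); last first.
  by apply: continuous_bigsum => q; exact: continuous_cosM.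
rewrite (pfun_sum _ pL); last by move=> p; exact: continuous_cosM.
rewrite big_allpairs /= expr2 -mulrA mulr_sumr.
congr (_ * _); apply: eq_bigr => m _; congr (_ * _); apply: eq_bigr => n _.
exact: LamE.
Qed.

(** Multiplying [exp_average2 a N] by [1 - exp_average2 id n] kills the end
    points of [0, 1] and allows bounded convergence; the cost is
    [Lam (exp_average2 id n)], which is [quadratic_average gam id n] and is small
    for a suitable [n]. *)
Theorem quadratic_average_cvg0 (R : realType) (gam : nat -> R) (a : nat -> nat) :
  positive_definite gam ->
  quadratic_average gam id @ \oo --> 0 ->
  (forall theta : R, 0 < theta < 1 -> exp_average2 a ^~ theta @ \oo --> 0) ->
  quadratic_average gam a @ \oo --> 0.
Proof.
move=> /herglotz[Lam pL LamE] gam0 a0.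
have QE b N : quadratic_average gam b N = Lam (exp_average2 b N).
  by rewrite (pfun_exp_average2 _ _ pL LamE).
have cE := @continuous_exp_average2 R.
have cM (F G : R -> R) : continuous F -> continuous G -> continuous (fun x => F x * G x).
  by move=> cF cG x; apply: cvgM; [exact: cF|exact: cG].
have cB (F G : R -> R) : continuous F -> continuous G -> continuous (fun x => F x - G x).
  by move=> cF cG x; apply: cvgB; [exact: cF|exact: cG].
have c1 : continuous (fun _ : R => 1 : R) by move=> x; exact: cvg_cst.
apply/cvgrPdist_lt => eps eps0.
have [n /andP[n0 nP]] : exists n, (0 < n)%N && (quadratic_average gam id n < eps / 2).
  move/cvgrPdist_lt : gam0 => /(_ _ (divr_gt0 eps0 (ltr0n _ 2)))[k _ kP].
  exists k.+1; have := kP k.+1 (leqnSn k); rewrite sub0r normrN /=.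
  exact: le_lt_trans (ler_norm _).
pose p N (theta : R) := exp_average2 a N theta * (1 - exp_average2 id n theta).
have cp N : continuous (p N) by apply: cM => //; apply: cB.
have := pfun_cvg0 (@segment_compact R 0 1) pL cp _ _.
have p01 N theta : `[0, 1]%classic theta -> 0 <= p N theta <= 1.
  move=> _; rewrite /p mulr_ge0 ?subr_ge0 ?exp_average2_le1 ?exp_average2_ge0//=.
  rewrite -[leRHS]mulr1 ler_pM ?subr_ge0 ?exp_average2_le1 ?exp_average2_ge0//.
  by rewrite gerBl exp_average2_ge0.
move=> /(_ p01) H.
have e1 (theta : R) : theta = 0 \/ theta = 1 -> exp_average2 id n theta = 1.
  move=> theta01; rewrite exp_average2E.
  have C1 j : cos (2 * pi * j%:R * theta) = 1.
    case: theta01 => ->; first by rewrite mulr0 cos0.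
    rewrite mulr1 -[LHS]/(cos _) (_ : 2 * pi * j%:R = 0 + pi *+ 2 *+ j); last first.
      by rewrite add0r -mulrnA -(mulr_natr pi) natrM; ring.
    by rewrite (periodicn (@cosD2pi R)) cos0.
  rewrite /quadratic_average.
  under [X in average X]eq_fun => m do under [X in average X]eq_fun => l do rewrite C1.
  by rewrite !average_cst.
have p0 theta : `[0, 1]%classic theta -> p ^~ theta @ \oo --> 0.
  rewrite /= in_itv /= => /andP[]; rewrite le_eqVlt => /predU1P[<- _|t0].
    rewrite /p e1; last by left.
    by under eq_fun do rewrite subrr mulr0; exact: cvg_cst.
  rewrite le_eqVlt => /predU1P[->|t1].
    rewrite /p e1; last by right.
    by under eq_fun do rewrite subrr mulr0; exact: cvg_cst.
  rewrite -[X in _ `=>` nbhs X](mul0r (1 - exp_average2 id n theta)).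
  by apply: cvgMl; apply: a0; rewrite t0.
move: H => /(_ p0) /cvgrPdist_lt /(_ _ (divr_gt0 eps0 (ltr0n _ 2)))[k _ kP].
exists k => // N /= kN; have := kP N kN; rewrite !sub0r !normrN => pN.
rewrite QE ger0_norm; last first.
  by apply: (pfun_ge0 pL) => // theta _; exact: exp_average2_ge0.
have -> : exp_average2 a N =
    fun theta => p N theta + exp_average2 a N theta * exp_average2 id n theta.
  by apply/funext => theta; rewrite /p -mulrDr subrK mulr1.
rewrite (pfunD pL)//; last exact: cM.
have : Lam (fun x => exp_average2 a N x * exp_average2 id n x) <=
    quadratic_average gam id n.
  rewrite QE; apply: (pfun_le pL) => //; first exact: cM.
  by move=> x _; rewrite ler_piMl ?exp_average2_ge0 ?exp_average2_le1.
move: pN nP; have := ler_norm (Lam (p N)); lra.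
Qed.

(** * Expectations of bounded measurable functions *)

Definition bounded_measurable (R : realType) d (T : measurableType d)
    (h : T -> R) : Prop :=
  measurable_fun setT h /\ exists C : R, forall x, `|h x| <= C.

Section BoundedMeasurable.
Context (R : realType) d (T : measurableType d) (P : probability T R).
Implicit Types h k : T -> R.

Lemma bounded_measurable_integrable h : bounded_measurable h ->
  P.-integrable setT (EFin \o h).
Proof.
move=> [mh [C hC]]; apply: measurable_bounded_integrable => //.
  by rewrite -ge0_fin_numE ?fin_num_measure.
exists C; split=> [|D CD x _ /=]; first exact: num_real.
exact: le_trans (hC x) (ltW CD).
Qed.

Lemma bounded_measurable_cst (c : R) : bounded_measurable (fun _ : T => c).
Proof. by split; [exact: measurable_cst|exists `|c|]. Qed.

Lemma bounded_measurableD h k : bounded_measurable h -> bounded_measurable k ->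
  bounded_measurable (fun x => h x + k x).
Proof.
move=> [mh [C hC]] [mk [D kD]]; split; first exact: measurable_funD.
by exists (C + D) => x; rewrite (le_trans (ler_normD _ _))// lerD.
Qed.

Lemma bounded_measurableM h k : bounded_measurable h -> bounded_measurable k ->
  bounded_measurable (fun x => h x * k x).
Proof.
move=> [mh [C hC]] [mk [D kD]]; split; first exact: measurable_funM.
by exists (C * D) => x; rewrite normrM ler_pM.
Qed.

Lemma bounded_measurableB h k : bounded_measurable h -> bounded_measurable k ->
  bounded_measurable (fun x => h x - k x).
Proof.
move=> bh bk; apply: bounded_measurableD => //.
under eq_fun do rewrite -mulN1r.
exact/bounded_measurableM/bk/bounded_measurable_cst.
Qed.

Lemma bounded_measurable_sum (I : Type) (s : seq I) (h : I -> T -> R) :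
  (forall i, bounded_measurable (h i)) ->
  bounded_measurable (fun x => \sum_(i <- s) h i x).
Proof.
move=> bh; elim: s => [|i s IH].
  under eq_fun do rewrite big_nil; exact: bounded_measurable_cst.
under eq_fun do rewrite big_cons; exact: bounded_measurableD.
Qed.

Lemma bounded_measurable_max0 h : bounded_measurable h ->
  bounded_measurable (fun x => Num.max 0 (h x)).
Proof.
move=> [mh [C hC]]; split.
  by apply: measurable_maxr => //; exact: measurable_cst.
exists C => x; case: (leP 0 (h x)) => _ //.
by rewrite normr0 (le_trans _ (hC x)).
Qed.

Lemma bounded_measurable_indic (A : set T) : measurable A ->
  bounded_measurable (\1_A : T -> R).
Proof.
move=> mA; split; first exact: measurable_indic.
by exists 1 => x; rewrite indicE; case: (_ \in _); rewrite ?normr1 ?normr0.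
Qed.

Lemma bounded_measurable_average (h : nat -> T -> R) N :
  (forall n, bounded_measurable (h n)) ->
  bounded_measurable (fun x => average (fun n => h n x) N).
Proof.
move=> bh; apply: bounded_measurableM; first exact: bounded_measurable_cst.
exact: bounded_measurable_sum.
Qed.

Lemma expectationD h k : bounded_measurable h -> bounded_measurable k ->
  \int[P]_x (h x + k x) = \int[P]_x h x + \int[P]_x k x.
Proof. by move=> bh bk; apply: RintegralD => //; exact: bounded_measurable_integrable. Qed.

Lemma expectationZ c h : bounded_measurable h ->
  \int[P]_x (c * h x) = c * \int[P]_x h x.
Proof. by move=> bh; apply: RintegralZl => //; exact: bounded_measurable_integrable. Qed.

Lemma expectation_cst c : \int[P]_x c = c.
Proof. 
rewrite Rintegral_cst// -[RHS]mulr1; congr (_ * _).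
by rewrite -[RHS]/(fine 1%E); congr fine; exact: probability_setT. Qed.

Lemma expectationB h k : bounded_measurable h -> bounded_measurable k ->
  \int[P]_x (h x - k x) = \int[P]_x h x - \int[P]_x k x.
Proof. by move=> bh bk; apply: RintegralB => //; exact: bounded_measurable_integrable. Qed.

Lemma expectation_le h k : bounded_measurable h -> bounded_measurable k ->
  (forall x, h x <= k x) -> \int[P]_x h x <= \int[P]_x k x.
Proof.
by move=> bh bk hk; apply: le_Rintegral => //; exact: bounded_measurable_integrable.
Qed.

Lemma expectation_sum (I : Type) (s : seq I) (h : I -> T -> R) :
  (forall i, bounded_measurable (h i)) ->
  \int[P]_x (\sum_(i <- s) h i x) = \sum_(i <- s) \int[P]_x h i x.
Proof.
move=> bh; elim: s => [|i s IH].
  by under eq_Rintegral do rewrite big_nil; rewrite big_nil expectation_cst.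
under eq_Rintegral do rewrite big_cons.
by rewrite big_cons -IH expectationD//; exact: bounded_measurable_sum.
Qed.

Lemma bounded_convergence (h : nat -> T -> R) (k : T -> R) (C : R) :
  (forall n, measurable_fun setT (h n)) -> bounded_measurable k ->
  (forall n x, `|h n x| <= C) ->
  {ae P, forall x, h ^~ x @ \oo --> k x} ->
  (fun n => \int[P]_x h n x) @ \oo --> \int[P]_x k x.
Proof.
move=> mh bk hC hk.
have bh n : bounded_measurable (h n) by split=> //; exists C.
have [|||||_ _ H] := @dominated_convergence _ _ _ P setT measurableT
    (fun n => EFin \o h n) (EFin \o k) (EFin \o cst C).
- by move=> n; apply/measurable_EFinP.
- by apply/measurable_EFinP; case: bk.
- by apply: filterS hk => x hx _; apply: cvg_EFin => //; exact: nearW.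
- exact/bounded_measurable_integrable/bounded_measurable_cst.
- by apply: aeW => x n _; rewrite /= lee_fin.
apply: fine_cvg; rewrite fineK; first exact: H.
by apply: integrable_fin_num => //; exact: bounded_measurable_integrable.
Qed.

End BoundedMeasurable.

(** * Correlations of a measure-preserving map *)

Section MeasurePreserving.
Context (R : realType) d (T : measurableType d) (P : probability T R) (g : T -> T).
Hypothesis mg : measurable_fun setT g.
Hypothesis Pg : forall A, measurable A -> P (g @^-1` A) = P A.
Implicit Types h k : T -> R.

Lemma bounded_measurable_comp h : bounded_measurable h ->
  bounded_measurable (fun x => h (g x)).
Proof. by move=> [mh [C hC]]; split; [exact: measurableT_comp|exists C]. Qed.

Lemma bounded_measurable_iter h n : bounded_measurable h ->
  bounded_measurable (fun x => h (iter n g x)).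
Proof.
by move=> bh; elim: n => // n /bounded_measurable_comp; under eq_fun do rewrite -iterSr.
Qed.

Lemma expectation_comp h : bounded_measurable h ->
  \int[P]_x h (g x) = \int[P]_x h x.
Proof.
move=> bh; rewrite /Rintegral; congr fine.
rewrite -(@integral_pushforward _ _ _ _ R g mg P setT (EFin \o h))//.
- by apply: eq_measure_integral => A mA _; exact: Pg.
- by apply/measurable_EFinP; case: bh.
- exact/bounded_measurable_integrable/bounded_measurable_comp.
Qed.

Lemma expectation_iter h n : bounded_measurable h ->
  \int[P]_x h (iter n g x) = \int[P]_x h x.
Proof.
move=> bh; elim: n => // n IH; under eq_Rintegral do rewrite iterSr.
by rewrite (expectation_comp (bounded_measurable_iter n bh)).
Qed.

Definition correlation h (n : nat) : R := \int[P]_x (h x * h (iter n g x)).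

Lemma correlationE h m n : bounded_measurable h ->
  \int[P]_x (h (iter m g x) * h (iter n g x)) = correlation h `|m%:Z - n%:Z|%N.
Proof.
move=> bh; wlog : m n / (m <= n)%N.
  move=> H; have [/H//|/ltnW nm] := leqP m n.
    by rewrite distnC -H//; apply: eq_Rintegral => x _; rewrite mulrC.
move=> mn; have -> : `|m%:Z - n%:Z|%N = (n - m)%N by lia.
rewrite /correlation -[RHS](expectation_iter m); last first.
  by apply: bounded_measurableM => //; exact: bounded_measurable_iter.
by apply: eq_Rintegral => x _; rewrite -iterD subnK.
Qed.

(** The quadratic form is the integral of the square of
    [\sum_k c k * h \o g^k]. *)
Lemma correlation_positive_definite h : bounded_measurable h ->
  positive_definite (correlation h).
Proof.
move=> bh c M.
have bi n : bounded_measurable (fun x => h (iter n g x)).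
  exact: bounded_measurable_iter.
have bc n : bounded_measurable (fun x => c n * h (iter n g x)).
  exact/bounded_measurableM/bi/bounded_measurable_cst.
have -> : \sum_(0 <= k < M) \sum_(0 <= l < M)
      c k * c l * correlation h `|k%:Z - l%:Z|%N =
    \int[P]_x (\sum_(0 <= k < M) c k * h (iter k g x)) ^+ 2.
  under [RHS]eq_Rintegral => x _.
    rewrite expr2 mulr_suml.
    under eq_bigr do rewrite mulr_sumr.
    over.
  rewrite expectation_sum => [|k]; last first.
    by apply: bounded_measurable_sum => l; exact: bounded_measurableM.
  apply: eq_bigr => k _; rewrite expectation_sum => [|l]; last first.
    exact: bounded_measurableM.
  apply: eq_bigr => l _; rewrite -correlationE// -expectationZ; last first.
    exact: bounded_measurableM.
  by apply: eq_Rintegral => x _; rewrite mulrACA.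
by apply: Rintegral_ge0 => x _; exact: sqr_ge0.
Qed.

Lemma expectation_average_sqr h (b : nat -> nat) N : bounded_measurable h ->
  \int[P]_x (average (fun n => h (iter (b n) g x)) N) ^+ 2 =
  quadratic_average (correlation h) b N.
Proof.
move=> bh.
have bi n : bounded_measurable (fun x => h (iter n g x)).
  exact: bounded_measurable_iter.
have bii m n : bounded_measurable (fun x => h (iter m g x) * h (iter n g x)).
  exact: bounded_measurableM.
transitivity (\int[P]_x (average (fun m => average (fun n =>
    h (iter (b m) g x) * h (iter (b n) g x)) N) N)).
  apply: eq_Rintegral => x _; rewrite /average exprMn expr2 -mulrA.
  congr (_ * _); rewrite expr2 mulr_suml mulr_sumr; apply: eq_bigr => m _.
  by rewrite mulr_sumr.
rewrite /quadratic_average /average expectationZ; last first.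
  apply: bounded_measurable_sum => m.
  apply: bounded_measurableM; first exact: bounded_measurable_cst.
  exact: bounded_measurable_sum.
rewrite expectation_sum => [|m]; last first.
  apply: bounded_measurableM; first exact: bounded_measurable_cst.
  exact: bounded_measurable_sum.
congr (_ * _); apply: eq_bigr => m _.
rewrite expectationZ; last exact: bounded_measurable_sum.
rewrite expectation_sum//; congr (_ * _); apply: eq_bigr => n _.
by rewrite -correlationE.
Qed.

End MeasurePreserving.

(** * Mean ergodic theorem along uniformly behaved times *)

Definition ergodic (R : realType) d (T : measurableType d) (P : probability T R)
    (g : T -> T) : Prop :=
  forall A, measurable A -> g @^-1` A = A -> P A = 0%E \/ P A = 1%E.

Definition birkhoff_sum (R : realType) (T : Type) (g : T -> T) (h : T -> R)
    (n : nat) (x : T) : R := \sum_(0 <= k < n) h (iter k g x).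

(** The maximum of the Birkhoff sums of orders [0] to [n]; the recursion on the
    first term of the orbit is what makes [birkhoff_max_drop] immediate. *)
Fixpoint birkhoff_max (R : realType) (T : Type) (g : T -> T) (h : T -> R)
    (n : nat) (x : T) : R :=
  if n is m.+1 then Num.max 0 (h x + birkhoff_max g h m (g x)) else 0.

Section BirkhoffMax.
Context (R : realType) (T : Type) (g : T -> T) (h : T -> R).

Lemma birkhoff_max_ge0 n x : 0 <= birkhoff_max g h n x.
Proof. by case: n => //= n; rewrite le_max lexx. Qed.

Lemma birkhoff_max_nondecr m n x : (m <= n)%N ->
  birkhoff_max g h m x <= birkhoff_max g h n x.
Proof.
move=> /subnK <-; elim: (n - m)%N => [//|k IH].
rewrite addSn; apply: le_trans IH _; elim: (k + m)%N x => [|j IH] x.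
  exact: birkhoff_max_ge0.
by rewrite /= ge_max !le_max lexx /= lerD2l IH orbT.
Qed.

Lemma birkhoff_sum_le_max n x : birkhoff_sum g h n x <= birkhoff_max g h n x.
Proof.
elim: n x => [|n IH] x; first by rewrite /birkhoff_sum big_nil.
rewrite /birkhoff_sum big_nat_recl//= le_max; apply/orP; right.
rewrite lerD2l; apply: le_trans (IH _).
by rewrite le_eqVlt; apply/orP; left; apply/eqP; apply: eq_bigr => k _; rewrite -iterSr.
Qed.

(** The pointwise form of the maximal ergodic inequality: where the maximum is
    positive it is attained after at least one step, hence is at most
    [h x] plus the maximum at [g x]. *)
Lemma birkhoff_max_drop n x :
  birkhoff_max g h n x - birkhoff_max g h n (g x) <=
  h x * (0 < birkhoff_max g h n x)%R%:R.
Proof.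
case: ltP => [|n0].
  case: n => [|n]; first by rewrite ltxx.
  have := @birkhoff_max_nondecr n n.+1 (g x) (leqnSn n).
  set u := birkhoff_max g h n.+1 (g x).
  by rewrite /= lt_max ltxx /= => un v0; rewrite (max_idPr (ltW v0)) mulr1; lra.
by rewrite mulr0 subr_le0 (le_trans n0) ?birkhoff_max_ge0.
Qed.

End BirkhoffMax.

Section ErgodicTheorem.
Context (R : realType) d (T : measurableType d) (P : probability T R) (g : T -> T).
Hypothesis mg : measurable_fun setT g.
Hypothesis Pg : forall A, measurable A -> P (g @^-1` A) = P A.
Implicit Types h : T -> R.

Lemma bounded_measurable_birkhoff_max h n : bounded_measurable h ->
  bounded_measurable (birkhoff_max g h n).
Proof.
move=> bh; elim: n => [|n IH]; first exact: bounded_measurable_cst.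
apply/bounded_measurable_max0/bounded_measurableD => //.
exact: bounded_measurable_comp.
Qed.

Lemma measurable_birkhoff_max_gt h n c : bounded_measurable h ->
  measurable [set x | c < birkhoff_max g h n x].
Proof.
move=> /(bounded_measurable_birkhoff_max n)[mm _].
rewrite -[X in measurable X]setTI.
have := mm measurableT `]c, +oo[%classic (measurable_itv _).
by congr (measurable (_ `&` _)); apply/seteqP; split=> x /=; rewrite in_itv/= andbT.
Qed.

(** Integrating [birkhoff_max_drop]: its left-hand side is a coboundary. *)
Theorem maximal_ergodic h n : bounded_measurable h ->
  0 <= \int[P]_x (h x * \1_[set x | 0 < birkhoff_max g h n x] x).
Proof.
move=> bh; have bm := bounded_measurable_birkhoff_max n bh.
have bmg := bounded_measurable_comp mg bm.
have E0 : 0 = \int[P]_x (birkhoff_max g h n x - birkhoff_max g h n (g x)).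
  by rewrite expectationB// (expectation_comp mg Pg)// subrr.
rewrite [leLHS]E0; apply: expectation_le; first exact: bounded_measurableB.
  apply/bounded_measurableM/bounded_measurable_indic => //.
  exact: measurable_birkhoff_max_gt.
move=> x; rewrite indicE; have -> : (x \in [set x | 0 < birkhoff_max g h n x]) =
    (0 < birkhoff_max g h n x) by apply/idP/idP; rewrite inE.
exact: birkhoff_max_drop.
Qed.

Definition birkhoff_unbounded h : set T :=
  \bigcap_(C in @setT nat) \bigcup_n [set x | C%:R < birkhoff_max g h n x].

(** Passing from [x] to [g x] changes the maxima by a bounded amount. *)
Lemma birkhoff_unbounded_invariant h : bounded_measurable h ->
  g @^-1` birkhoff_unbounded h = birkhoff_unbounded h.
Proof.
move=> [_ [B hB]]; have [b bB] : exists b : nat, B <= b%:R.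
  by exists (Num.truncn `|B|).+1; rewrite (le_trans (ler_norm _))// ltW// truncnS_gt.
apply/seteqP; split=> x /= ux C _.
- have [n _ /= nC] := ux (C + b)%N I; exists n.+1 => //=.
  rewrite lt_max; apply/orP; right.
  have := hB x; rewrite ler_norml => /andP[]; move: nC; rewrite natrD; lra.
- have [n _ /= nC] := ux (C + b)%N I; exists n => //=.
  have : birkhoff_max g h n x <= birkhoff_max g h n.+1 x by exact: birkhoff_max_nondecr.
  rewrite /= le_max => /orP[n0|].
    by move: nC; rewrite ltNge (le_trans n0).
  have := hB x; rewrite ler_norml => /andP[]; move: nC; rewrite natrD; lra.
Qed.

Lemma measurable_birkhoff_unbounded h : bounded_measurable h ->
  measurable (birkhoff_unbounded h).
Proof.
move=> bh; apply: bigcapT_measurable => C; apply: bigcup_measurable => n _.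
exact: measurable_birkhoff_max_gt.
Qed.

(** If the invariant set had full measure, the sets where [birkhoff_max g h n]
    is positive would exhaust the space, and the maximal inequality would give
    [0 <= \int[P]_x h x] in the limit. *)
Lemma birkhoff_unbounded_null h : ergodic P g -> bounded_measurable h ->
  \int[P]_x h x < 0 -> P (birkhoff_unbounded h) = 0.
Proof.
move=> eg bh; rewrite ltNge => /negP h0.
have mA := measurable_birkhoff_unbounded bh.
have [//|PA] := eg _ mA (birkhoff_unbounded_invariant bh).
exfalso; apply: h0.
have [mh [C hC]] := bh.
pose E n := [set x | 0 < birkhoff_max g h n x].
have mE n : measurable (E n) by exact: measurable_birkhoff_max_gt.
have : (fun n => \int[P]_x (h x * \1_(E n) x)) @ \oo --> \int[P]_x h x.
  apply: (@bounded_convergence _ _ _ _ _ _ C) => //.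
  - by move=> n; apply: measurable_funM => //; exact: measurable_indic.
  - move=> n x; rewrite normrM (le_trans _ (hC x))// ler_piMr//.
    by rewrite indicE; case: (_ \in _); rewrite ?normr1 ?normr0.
  - exists (~` birkhoff_unbounded h); split; first exact: measurableC.
      by rewrite probability_setC// PA subee.
    apply: subsetC => x /(_ 0%N I)[n _ /= nx].
    apply: cvg_near_cst; exists n => // m /= nm; rewrite indicE mem_set ?mulr1//=.
    by apply: lt_le_trans nx _; exact: birkhoff_max_nondecr.
by move=> /cvgr_to_ge; apply; apply: nearW => n; exact: maximal_ergodic.
Qed.


(** Apply [birkhoff_unbounded_null] to [h - eps], of negative integral. *)
Lemma birkhoff_sum_upper h (eps : R) : ergodic P g -> bounded_measurable h ->
  \int[P]_x h x = 0 -> 0 < eps ->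
  {ae P, forall x, exists C : R, forall n, birkhoff_sum g h n x <= n%:R * eps + C}.
Proof.
move=> eg bh h0 eps0; pose k x := h x - eps.
have be : bounded_measurable (fun _ : T => eps) by exact: bounded_measurable_cst.
have bk : bounded_measurable k by exact: bounded_measurableB.
have k0 : \int[P]_x k x < 0.
  by rewrite expectationB// h0 expectation_cst sub0r oppr_lt0.
exists (birkhoff_unbounded k); split.
- exact: measurable_birkhoff_unbounded.
- exact: birkhoff_unbounded_null.
- move=> x nx C _; apply: contrapT => nC; apply: nx; exists C%:R => n.
  have -> : birkhoff_sum g h n x = birkhoff_sum g k n x + n%:R * eps.
    by rewrite /birkhoff_sum sumrB sumr_const_nat subn0 mulr_natl subrK.
  rewrite addrC lerD2l (le_trans (birkhoff_sum_le_max _ _ _ _))// leNgt.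
  by apply/negP => Cn; apply: nC; exists n.
Qed.

(** The pointwise ergodic theorem for ergodic maps, from the upper bounds
    [birkhoff_sum_upper] for [h] and [- h] with [eps] ranging over the inverses
    of the positive integers. *)
Theorem birkhoff_ae_cvg0 h : ergodic P g -> bounded_measurable h ->
  \int[P]_x h x = 0 ->
  {ae P, forall x, average (fun n => h (iter n g x)) @ \oo --> 0}.
Proof.
move=> eg bh h0.
have up k : bounded_measurable k -> \int[P]_x k x = 0 ->
    {ae P, forall x, forall j : nat, exists C : R, forall N,
      \sum_(1 <= n < N.+1) k (iter n g x) <= N%:R * j.+1%:R^-1 + C}.
  move=> bk k0; apply/ae_foralln => j.
  (* Averages start at n = 1, so they are Birkhoff averages of k \o g. *)
  have bkg := bounded_measurable_comp mg bk.
  have kg0 : \int[P]_x k (g x) = 0 by rewrite (expectation_comp mg Pg).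
  have := birkhoff_sum_upper eg bkg kg0 (_ : 0 < j.+1%:R^-1 :> R).
  rewrite invr_gt0 ltr0n => /(_ isT); apply: filterS => x [C hC].
  by exists C => N; rewrite big_add1 /=; exact: hC.
have bN : bounded_measurable (fun x => - h x).
  under eq_fun do rewrite -sub0r.
  by apply: bounded_measurableB => //; exact: bounded_measurable_cst.
have N0 : \int[P]_x - h x = 0.
  under eq_Rintegral do rewrite -mulN1r.
  by rewrite expectationZ// h0 mulr0.
apply: filterS2 (up h bh h0) (up _ bN N0) => x upx lox.
apply/cvgrPdist_lt => eps eps0.
have [j jeps] : exists j : nat, j.+1%:R^-1 < eps / 2.
  exists (Num.truncn (eps / 2)^-1); rewrite invf_plt ?posrE ?divr_gt0//.
  by rewrite truncnS_gt.
have [C CP] := upx j; have [D DP] := lox j.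
pose B := `|C| + `|D| + 1.
have B0 : 0 < B by rewrite ltr_wpDl ?addr_ge0.
pose n0 := (Num.truncn (B / (eps / 2))).+1.
exists n0 => // N /= n0N.
have N0' : 0 < N%:R :> R by rewrite ltr0n (leq_trans _ n0N).
have BN : B < N%:R * (eps / 2).
  rewrite -ltr_pdivrMr ?divr_gt0// (lt_le_trans (truncnS_gt _))//.
  by rewrite ler_nat.
have jN : N%:R * j.+1%:R^-1 <= N%:R * (eps / 2) by rewrite ler_wpM2l// ltW.
rewrite sub0r normrN /average normrM ger0_norm ?invr_ge0// ltr_pdivrMl//.
have := CP N; have := DP N; rewrite sumrN.
have CC := ler_norm C; have DD := ler_norm D.
have CC' := normr_ge0 C; have DD' := normr_ge0 D.
move: BN jN; rewrite /B ltr_norml.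
set s := \sum_(_ <= _ < _) _; set e := N%:R * (eps / 2).
have -> : N%:R * eps = e + e by rewrite /e; field.
set e' := N%:R / _; lra.
Qed.

(** Both the conclusion and, by bounded convergence, the Birkhoff averages are
    instances of [expectation_average_sqr], so [quadratic_average_cvg0] applies to
    the correlations of [h]. *)
Theorem ergodic_mean_cvg0 h (a : nat -> nat) : ergodic P g ->
  bounded_measurable h -> \int[P]_x h x = 0 ->
  (forall theta : R, 0 < theta < 1 -> exp_average2 a ^~ theta @ \oo --> 0) ->
  (fun N => \int[P]_x (average (fun n => h (iter (a n) g x)) N) ^+ 2) @ \oo --> 0.
Proof.
move=> eg bh h0 a0.
under eq_fun do rewrite (expectation_average_sqr mg Pg)//.
apply: quadratic_average_cvg0 => //; first exact: correlation_positive_definite.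
have -> : quadratic_average (correlation P g h) id =
    (fun N => \int[P]_x (average (fun n => h (iter n g x)) N) ^+ 2).
  by apply/funext => N; rewrite (expectation_average_sqr mg Pg).
have [mh [C hC]] := bh.
have avgC N x : `|average (fun n => h (iter n g x)) N| <= `|C|.
  case: N => [|N]; first by rewrite /average invr0 mul0r normr0.
  apply: le_trans (ler_norm_average _ _) _.
  rewrite -[leRHS](@average_cst R _ N.+1)//; apply: ler_average => n _.
  exact: le_trans (hC _) (ler_norm _).
rewrite -[X in _ `=>` nbhs X](expectation_cst P).
apply: (@bounded_convergence _ _ _ _ _ _ (`|C| ^+ 2)).
- move=> N; have [] // := @bounded_measurable_average R d T (fun n x => h (iter n g x)) N _.
    by move=> n; exact: bounded_measurable_iter.
  by move=> mA _; apply: measurable_funX.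
- exact: bounded_measurable_cst.
- by move=> N x; rewrite normrX lerXn2r ?nnegrE.
- apply: filterS (birkhoff_ae_cvg0 eg bh h0) => x hx.
  rewrite -[X in _ `=>` nbhs X](mulr0 0); under eq_fun do rewrite expr2.
  exact: cvgM.
Qed.

End ErgodicTheorem.

(** * Upper limits and complex sequences *)

Lemma limn_esup_lt_near (R : realType) (u : nat -> R) (eps : R) :
  (limn_esup (fun n => (u n)%:E) < eps%:E)%E -> \forall n \near \oo, u n < eps.
Proof.
rewrite /limn_esup limf_esupE => /ereal_inf_lt[_ [V [k _ kV] <-] Veps].
exists k => // n /= /kV Vn; rewrite -lte_fin; apply: le_lt_trans Veps.
by apply: ereal_sup_ubound; exists n.
Qed.

Section ComplexConvergence.
Context (R : realType).
Local Open Scope complex_scope.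

Lemma ler_norm_Re (z : R[i]) : `|complex.Re z|%:C <= `|z|.
Proof.
by rewrite normc_def lecR -sqrtr_sqr ler_wsqrtr// lerDl sqr_ge0.
Qed.

Lemma ler_norm_Im (z : R[i]) : `|complex.Im z|%:C <= `|z|.
Proof.
by rewrite normc_def lecR -sqrtr_sqr ler_wsqrtr// lerDr sqr_ge0.
Qed.

Lemma ler_norm_ReIm (z : R[i]) : `|z| <= (`|complex.Re z| + `|complex.Im z|)%:C.
Proof.
rewrite normc_def lecR -[leRHS]ger0_norm ?addr_ge0// -sqrtr_sqr ler_wsqrtr//.
rewrite sqrrD !real_normK ?num_real// lerD2r lerDl.
by rewrite mulrn_wge0// mulr_ge0.
Qed.

Lemma complex_gt0P (e : R[i]) : 0 < e -> exists2 r : R, 0 < r & e = r%:C.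
Proof.
by case: e => r s; rewrite ltcE /= => /andP[/eqP -> r0]; exists r.
Qed.

Lemma cvg_Re (T : Type) (F : set_system T) {FF : Filter F} (u : T -> R[i]^o)
    (l : R[i]^o) : u @ F --> l ->
  (fun t => complex.Re (u t)) @ F --> complex.Re l.
Proof.
move=> /cvgrPdist_lt H; apply/cvgrPdist_lt => e e0.
have e0' : (0 : R[i]) < e%:C by rewrite ltcR.
apply: filterS (H _ e0') => t.
by rewrite -ltcR; apply: le_lt_trans; rewrite -raddfB; exact: ler_norm_Re.
Qed.

Lemma cvg_Im (T : Type) (F : set_system T) {FF : Filter F} (u : T -> R[i]^o)
    (l : R[i]^o) : u @ F --> l ->
  (fun t => complex.Im (u t)) @ F --> complex.Im l.
Proof.
move=> /cvgrPdist_lt H; apply/cvgrPdist_lt => e e0.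
have e0' : (0 : R[i]) < e%:C by rewrite ltcR.
apply: filterS (H _ e0') => t.
by rewrite -ltcR; apply: le_lt_trans; rewrite -raddfB; exact: ler_norm_Im.
Qed.

Lemma cvg_complex (T : Type) (F : set_system T) {FF : Filter F} (u : T -> R[i]^o)
    (l : R[i]^o) :
  (fun t => complex.Re (u t)) @ F --> complex.Re l ->
  (fun t => complex.Im (u t)) @ F --> complex.Im l -> u @ F --> l.
Proof.
move=> /cvgrPdist_lt HR /cvgrPdist_lt HI; apply/cvgrPdist_lt => e.
move=> /complex_gt0P[r r0 ->].
have r2 : 0 < r / 2 by rewrite divr_gt0.
apply: filterS2 (HR _ r2) (HI _ r2) => t tR tI.
apply: le_lt_trans (ler_norm_ReIm _) _.
by rewrite ltcR !raddfB /= [ltRHS]splitr ltrD.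
Qed.

Lemma average_complex (u : nat -> R[i]) N :
  average u N = average (fun n => complex.Re (u n)) N +i*
                average (fun n => complex.Im (u n)) N.
Proof.
rewrite /average; have -> : N%:R^-1 = (N%:R^-1)%:C :> R[i].
  by rewrite fmorphV rmorph_nat.
apply/eqP; rewrite eq_complex -!raddf_sum; case: (\sum_(_ <= _ < _) _) => x y /=.
by rewrite !mul0r subr0 addr0 !eqxx.
Qed.

End ComplexConvergence.

Lemma uniformly_behaved_exp_average2 (R : realType) (a : nat -> nat) (theta : R) :
  uniformly_behaved R a -> 0 < theta < 1 ->
  exp_average2 a ^~ theta @ \oo --> 0.
Proof.
move=> ua /ua H.
have := cvg_Re H; under eq_fun do rewrite average_complex /=; move=> /(_ _) HR.
have := cvg_Im H; under eq_fun do rewrite average_complex /=; move=> /(_ _) HI.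
have : exp_average2 a ^~ theta @ \oo --> (0 * 0 + 0 * 0 : R).
  by apply: cvgD; under eq_fun do rewrite expr2; apply: cvgM; (exact: HR || exact: HI).
by rewrite mulr0 addr0.
Qed.

(** * Borel probabilities and continuous functions on metric spaces *)

(** Conditioning [nu] on an invariant set of positive measure yields an invariant
    probability; by uniqueness it is [nu], so the set has full measure. *)
Lemma uniquely_ergodic_ergodic (R : realType) (Y : ptopologicalType) (g : Y -> Y)
    (nu : probability (borel Y) R) :
  uniquely_ergodic R g -> invariant_measure g nu -> ergodic nu g.
Proof.
move=> [mu _ uniq] inv A mA gA.
have [->|A0] := eqVneq (nu A) 0%E; [by left|right].
pose nuA : probability (borel Y) R := mnormalize (mrestr nu mA) nu.
have fA : nu A \is a fin_num by exact: fin_num_measure.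
have nuAE B : nuA B = (nu (B `&` A) * ((fine (nu A))^-1)%:E)%E.
  pose TA : set (borel Y) := setT `&` A.
  have -> : nuA B = (if (nu TA == 0%E) || (nu TA == +oo%E) then fun U => nu U
    else fun U => nu (U `&` A) * ((fine (nu TA))^-1)%:E)%E B by [].
  rewrite /TA setTI (negbTE A0) /=.
  by have /fin_numPlt/andP[_ /lt_eqF ->] := fA.
have invA : invariant_measure g nuA.
  move=> B mB; rewrite !nuAE -{1}gA -preimage_setI inv//.
  exact: measurableI.
have := uniq _ invA A mA; rewrite -(uniq _ inv A mA) nuAE setIid => <-.
rewrite -{1}(fineK fA) -EFinM divff//.
by apply: contra_neq A0; move: (fineK fA) => {2}<- ->.
Qed.

Section Continuous.
Context (R : realType) (Y : ptopologicalType).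

Lemma open_measurable_borel (U : set Y) :
  open U -> measurable (U : set (borel Y)).
Proof. by move=> oU; exact: sub_sigma_algebra. Qed.

Lemma continuous_measurable_borel (g : Y -> Y) :
  continuous g -> measurable_fun [set: borel Y] (g : borel Y -> borel Y).
Proof.
move=> /continuousP cg.
apply: (@measurability _ _ (borel Y) (borel Y) setT g (@open Y)) => // _ [U oU <-].
by rewrite setTI; apply: open_measurable_borel; exact: cg.
Qed.

Lemma continuous_bounded_measurable (h : Y -> R) (C : R) :
  continuous h -> (forall y, `|h y| <= C) ->
  bounded_measurable (h : borel Y -> R).
Proof.
move=> /continuousP ch hC; split; last by exists C.
apply: (measurability _ (RGenOpens.measurableE R)) => // _ [_ [x [y ->]] <-].
by rewrite setTI; apply: open_measurable_borel; apply: ch; exact: interval_open.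
Qed.

End Continuous.

Section MetricContinuity.
Context (R : realType) (X : metricType R).

Lemma continuous_mdistP (Y : metricType R) (f : X -> Y) :
  continuous f <-> forall x e, 0 < e -> exists2 r : R, 0 < r &
    forall y, mdist x y < r -> mdist (f x) (f y) < e.
Proof.
split=> [cf x e e0|H x].
  have := metricType_numDomainType.cvgr_dist_lt (cf x) e0.
  by move=> /(_ _)/metricType_numDomainType.nbhs_mdistP[r r0 rP]; exists r.
apply/metricType_numDomainType.cvgrPdist_lt => e e0.
have [r r0 rP] := H x e e0.
by apply/metricType_numDomainType.nbhs_mdistP; exists r.
Qed.

Lemma open_mdist_ball (x : X) (r : R) : open [set y | mdist x y < r].
Proof.
rewrite openE => y /= xy; apply/metricType_numDomainType.nbhs_mdistP.
exists (r - mdist x y) => [|z /= yz] /=; first by rewrite subr_gt0.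
by rewrite (le_lt_trans (metric_triangle x y z))// -ltrBrDl.
Qed.

(** Uniform continuity handles close points, boundedness the others, with
    [C = 2 * B / r] where [r] is a modulus of continuity for [eta]. *)
Lemma compact_almost_lipschitz (phi : X -> R) (eta : R) :
  compact [set: X] -> continuous phi -> 0 < eta ->
  exists2 C : R, 0 <= C & forall x y, `|phi x - phi y| <= eta + C * mdist x y.
Proof.
move=> cX cphi eta0.
have [B B0 phiB] := compact_continuous_bounded cX cphi.
have BP x : `|phi x| <= B by exact: phiB.
have [r r0 rP] : exists2 r : R, 0 < r &
    forall x y, mdist x y < r -> `|phi x - phi y| < eta.
  move: cX => /compact_near_coveringP /(_ R 0^'+
    (fun r x => forall y, mdist x y < r -> `|phi x - phi y| < eta) _) H.
  have : \forall r \near 0^'+, [set: X] `<=`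
      (fun x => forall y, mdist x y < r -> `|phi x - phi y| < eta).
    apply: H => x _.
    have /metricType_numDomainType.nbhs_mdistP[r /= r0 rP] :
        \forall y \near x, `|phi x - phi y| < eta / 2.
      by have /cvgrPdist_lt := cphi x; apply; rewrite divr_gt0.
    exists ([set y | mdist x y < r / 2], [set s | 0 < s < r / 2]).
      split => /=.
        by apply/metricType_numDomainType.nbhs_mdistP; exists (r / 2) => //=; rewrite divr_gt0.
      near=> s; apply/andP; split; near: s; first exact: nbhs_right_gt.
      by apply: nbhs_right_lt; rewrite divr_gt0.
    move=> [y s] [/= xy /andP[s0 sr]] z yz.
    have xz : mdist x z < r.
      apply: le_lt_trans (metric_triangle x y z) _.
      by rewrite [ltRHS]splitr ltrD// (lt_trans yz).
    have xy' : mdist x y < r by rewrite (lt_trans xy)// gtr_pMr// invf_lt1 ?ltr1n.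
    rewrite -(subrK (phi x) (phi y)) -addrA (le_lt_trans (ler_normD _ _))//.
    by rewrite [ltRHS]splitr ltrD// ?rP// distrC rP.
  move=> /(filterI (@nbhs_right_gt R 0)) /filter_ex[r [r0 rP]].
  by exists r => // x y; exact: rP.
exists (2 * B / r) => [|x y]; first by rewrite divr_ge0 ?mulr_ge0// ltW.
have [/rP/ltW xy|rxy] := ltP (mdist x y) r.
  by rewrite (le_trans xy)// lerDl mulr_ge0 ?mdist_ge0// divr_ge0 ?mulr_ge0// ltW.
apply: (@le_trans _ _ (2 * B)).
  by rewrite (le_trans (ler_normB _ _))// mulr_natl mulr2n lerD.
rewrite -[leLHS]add0r lerD ?(ltW eta0)// -mulrA ler_peMr ?mulr_ge0//.
by rewrite ler_pdivlMl// mulr1.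
Unshelve. all: by end_near. Qed.

End MetricContinuity.

(** * Minimal subsets *)

Section MinimalSystem.
Context (R : realType) (X : metricType R) (f : X -> X) (K : minimal_subset f).
Local Notation g := (minimal_restrict K).

Lemma val_iter_minimal_restrict n (y : minimal_space K) :
  \val (iter n g y) = iter n f (\val y).
Proof. by elim: n => //= n ->. Qed.

Lemma mdist_minimal_space (x y : minimal_space K) : mdist x y = mdist (\val x) (\val y).
Proof. by []. Qed.

Lemma continuous_minimal_restrict : continuous f -> continuous g.
Proof.
move=> /continuous_mdistP cf; apply/continuous_mdistP => x e e0.
by have [r r0 rP] := cf (\val x) e e0; exists r => // y; exact: rP.
Qed.

Lemma continuous_minimal_val : continuous (\val : minimal_space K -> X).
Proof. by apply/continuous_mdistP => x e e0; exists e => // y. Qed.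

(** Minimality, read in the metric space [K]. *)
Lemma minimal_orbit_visits (x y : minimal_space K) (r : R) : 0 < r ->
  exists n, mdist x (iter n g y) < r.
Proof.
move=> r0; have [_ _ _ dense] := minimal_setP K.
have : nbhs (\val x) [set z | mdist (\val x) z < r].
  by apply/metricType_numDomainType.nbhs_mdistP; exists r.
have Kx : minimal_set K (\val x) by exact/set_mem/valP.
have Ky : minimal_set K (\val y) by exact/set_mem/valP.
move=> /(dense _ Ky _ Kx)[_ [[n _ <-]]] /= xn.
by exists n; rewrite mdist_minimal_space val_iter_minimal_restrict.
Qed.

(** Since every orbit visits the ball, its preimages under the iterates of [g] cover
    [K]; by invariance they would all be null if the ball were. *)
Lemma invariant_measure_full_support (nu : probability (borel (minimal_space K)) R)
    (x : minimal_space K) (r : R) : continuous f ->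
  invariant_measure g nu -> 0 < r ->
  (0 < nu [set y | (mdist x y < r)%R])%E.
Proof.
move=> cf inv r0; rewrite lt0e measure_ge0 andbT; apply/negP => /eqP U0.
have mg := continuous_measurable_borel (continuous_minimal_restrict cf).
have mU := open_measurable_borel (open_mdist_ball x r).
pose U : set (borel (minimal_space K)) := [set y | mdist x y < r].
pose V n : set (borel (minimal_space K)) := iter n g @^-1` U.
have V0 n : measurable (V n) /\ nu (V n) = 0%E.
  elim: n => [//|n [mn n0]].
  have -> : V n.+1 = g @^-1` V n by apply/seteqP; split=> y; rewrite /V /= -iterSr.
  by rewrite inv//; split=> //; rewrite -[X in measurable X]setTI; exact: mg.
have : nu.-negligible (\bigcup_n V n).
  by apply: negligible_bigcup => n; apply/negligibleP; have [] := V0 n.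
have -> : \bigcup_n V n = setT.
  by rewrite -subTset => y _; have [n xn] := minimal_orbit_visits x y r0; exists n.
move=> /negligibleP -/(_ measurableT) /eqP.
by rewrite -[X in X == _]/(nu setT) probability_setT gt_eqF.
Qed.

End MinimalSystem.

Lemma average_almost_lipschitz (R : realType) (u v w : nat -> R) (eta C : R) N :
  (0 < N)%N -> (forall n, (1 <= n)%N -> `|u n - v n| <= eta + C * w n) ->
  `|average u N - average v N| <= eta + C * average w N.
Proof.
move=> N0 uvw; rewrite -averageB; apply: le_trans (ler_norm_average _ _) _.
by rewrite -averageZ -(average_cst eta N0) -averageD; exact: ler_average.
Qed.

(** Times outside the exceptional set [E] contribute at most
    [eta / 2 + C * eps], times in [E] at most [2 * B]; as the density of [E] is
    below [eps], the total is at most [eta / 2 + (C + 2 * B) * eps]. *)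
Lemma mean_lyapunov_stable_average (R : realType) (Y : metricType R)
    (a : nat -> nat) (g : Y -> Y) (h : Y -> R) (B eta : R) :
  mean_lyapunov_stable a g -> 0 <= B -> (forall y, `|h y| <= B) ->
  (forall eps, 0 < eps -> exists2 C : R, 0 <= C &
    forall x y, `|h x - h y| <= eps + C * mdist x y) ->
  0 < eta ->
  exists2 r : R, 0 < r & \forall N \near \oo, forall x y, mdist x y < r ->
    `|average (fun n => h (iter (a n) g x)) N -
      average (fun n => h (iter (a n) g y)) N| <= eta.
Proof.
move=> mls B0 hB hlip eta0.
have eta2 : 0 < eta / 2 by rewrite divr_gt0.
have [C C0 hC] := hlip _ eta2.
have D0 : 0 < C + 2 * B + 1 by rewrite ltr_wpDl// addr_ge0// mulr_ge0.
pose eps := eta / 2 / (C + 2 * B + 1).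
have eps0 : 0 < eps by rewrite divr_gt0.
have [r [E [r0 dE stab]]] := mls eps eps0.
exists r => //.
have := limn_esup_lt_near dE; apply: filterS2 (nbhs_infty_gt 0) => N N0 EN x y xy.
have step (n : nat) : (1 <= n)%N ->
    `|h (iter (a n) g x) - h (iter (a n) g y)| <=
    eta / 2 + C * eps + 2 * B * (a n \in E)%:R.
  move=> n1; case: (boolP (a n \in E)) => anE; rewrite ?mulr1 ?mulr0 ?addr0.
    apply: (@le_trans _ _ (2 * B)).
      by rewrite (le_trans (ler_normB _ _))// mulr_natl mulr2n lerD.
    by rewrite lerDr addr_ge0 ?(ltW eta2)// mulr_ge0// ltW.
  rewrite (le_trans (hC _ _))// lerD2l ler_wpM2l// ltW//.
  exact: stab.
apply: le_trans (average_almost_lipschitz N0 step) _.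
rewrite (average_count R (fun n => a n \in E)).
have : eps * (C + 2 * B + 1) = eta / 2 by rewrite /eps divfK// gt_eqF.
have : 2 * B * ((count (fun n => a n \in E) (index_iota 1 N.+1))%:R / N%:R) <=
    2 * B * eps by rewrite ler_wpM2l ?mulr_ge0// ltW.
lra.
Qed.

(** * Convergence on a minimal subset and on its basin *)

Section MinimalAverages.
Context (R : realType) (X : metricType R) (f : X -> X) (a : nat -> nat).
Hypotheses (cX : compact [set: X]) (cf : continuous f) (ua : uniformly_behaved R a).
Context (K : minimal_subset f).
Local Notation g := (minimal_restrict K).
Hypotheses (ueK : uniquely_ergodic R g) (mlsK : mean_lyapunov_stable a g).
Context (nu : probability (borel (minimal_space K)) R).
Hypothesis inv : invariant_measure g nu.

(** If [F N z], the centred average, had modulus at least [eps] for some large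
    [N], then the modulus of [F N] would be at least [eps / 4] on the whole ball
    [U] around [z], against the convergence of the mean squares to [0]. *)
Lemma minimal_average_cvg (phi : X -> R) (z : minimal_space K) :
  continuous phi ->
  average (fun n => phi (iter (a n) f (\val z))) @ \oo -->
    \int[nu]_y phi (\val (y : minimal_space K)).
Proof.
move=> cphi; set c := Rintegral _ _ _.
have [B B0 XB] := compact_continuous_bounded cX cphi.
have phiB x : `|phi x| <= B by exact: XB.
pose phiK (y : minimal_space K) := phi (\val y).
have cphiK : continuous phiK.
  by move=> y; apply: continuous_comp; [exact: continuous_minimal_val|exact: cphi].
have bphiK : bounded_measurable (phiK : borel (minimal_space K) -> R).
  by apply: (@continuous_bounded_measurable _ _ _ B) => // y; exact: phiB.
pose h (y : borel (minimal_space K)) := phiK y - c.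
have bh : bounded_measurable h.
  by apply: bounded_measurableB => //; exact: bounded_measurable_cst.
have h0 : \int[nu]_y h y = 0.
  rewrite expectationB//; last exact: bounded_measurable_cst.
  by rewrite expectation_cst subrr.
have mg := continuous_measurable_borel (continuous_minimal_restrict (K := K) cf).
have L2 := ergodic_mean_cvg0 mg inv (uniquely_ergodic_ergodic ueK inv) bh h0
  (fun theta => uniformly_behaved_exp_average2 ua).
pose F N y := average (fun n => h (iter (a n) g y)) N.
have FE N : (0 < N)%N ->
    F N z = average (fun n => phi (iter (a n) f (\val z))) N - c.
  move=> N0; rewrite /F averageB average_cst//; congr (average _ _ - _).
  by apply/funext => n; rewrite /phiK val_iter_minimal_restrict.
apply/cvgrPdist_lt => eps eps0.
have eps4 : 0 < eps / 4 by rewrite divr_gt0.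
have [r r0 near_eq] := mean_lyapunov_stable_average (h := phiK) mlsK B0
  (fun y => phiB (\val y))
  (fun e e0 => let: ex_intro2 C C0 HC := compact_almost_lipschitz cX cphi e0 in
     ex_intro2 _ _ C C0 (fun x y => HC (\val x) (\val y))) eps4.
pose U : set (borel (minimal_space K)) := [set y | mdist z y < r].
have mU : measurable U := open_measurable_borel (open_mdist_ball z r).
have U0 : 0 < fine (nu U).
  apply: fine_gt0; rewrite invariant_measure_full_support//=.
  by rewrite -ge0_fin_numE ?fin_num_measure.
have b1U : bounded_measurable (\1_U : _ -> R) by exact: bounded_measurable_indic.
have e2 : 0 < (eps / 4) ^+ 2 * fine (nu U) by rewrite mulr_gt0 ?exprn_gt0.
move/cvgrPdist_lt : L2 => /(_ _ e2).
apply: filterS3 near_eq (nbhs_infty_gt 0) => N near_eq N0 L2.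
rewrite distrC -FE// ltNge; apply/negP => epsF.
have : (eps / 4) ^+ 2 * fine (nu U) <= \int[nu]_y (F N y) ^+ 2.
  have -> : fine (nu U) = \int[nu]_y \1_U y.
    by rewrite /Rintegral integral_indic// setIT.
  rewrite -expectationZ//; apply: expectation_le.
  - by apply: bounded_measurableM => //; exact: bounded_measurable_cst.
  - under eq_fun do rewrite expr2.
    have bF : bounded_measurable (F N : borel (minimal_space K) -> R).
      apply: bounded_measurable_average => n; exact: bounded_measurable_iter.
    exact: bounded_measurableM.
  - move=> y; rewrite indicE; case: (boolP (y \in U)) => [yU|_]; last first.
      by rewrite mulr0 sqr_ge0.
    rewrite mulr1 -[leRHS]real_normK ?num_real// lerXn2r ?nnegrE// ?(ltW eps4)//.
    move: yU; rewrite inE => /near_eq.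
    have -> : average (fun n => phiK (iter (a n) g z)) N -
        average (fun n => phiK (iter (a n) g y)) N = F N z - F N y.
      by rewrite /F !averageB opprB addrA subrK.
    have := ler_normD (F N z - F N y) (F N y); rewrite subrK.
    move: epsF; lra.
move: L2; rewrite sub0r normrN -/(F N) => L2.
by have := le_lt_trans (ler_norm _) L2; lra.
Qed.

Lemma basin_average_cvg (phi : X -> R) (x : X) : basin a f K x -> continuous phi ->
  average (fun n => phi (iter (a n) f x)) @ \oo -->
    \int[nu]_y phi (\val (y : minimal_space K)).
Proof.
move=> bx cphi; apply/cvgrPdist_lt => eps eps0.
have eps3 : 0 < eps / 3 by rewrite divr_gt0.
have [C C0 phiC] := compact_almost_lipschitz cX cphi eps3.
have C1 : 0 < C + 1 by rewrite ltr_wpDl.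
have d0 : 0 < eps / 3 / (C + 1) by rewrite divr_gt0.
have [z Kz /limn_esup_lt_near xz] := bx _ d0.
have := @minimal_average_cvg phi (exist _ z (mem_set Kz)) cphi.
move/cvgrPdist_lt => /(_ _ eps3); apply: filterS3 xz (nbhs_infty_gt 0) => N xz N0 zN.
have := average_almost_lipschitz N0 (fun n _ => phiC (iter (a n) f x) (iter (a n) f z)).
have : C * average (fun n => mdist (iter (a n) f x) (iter (a n) f z)) N <= eps / 3.
  apply: (@le_trans _ _ (C * (eps / 3 / (C + 1)))); first by rewrite ler_wpM2l// ltW.
  by rewrite mulrCA ger_pMr// ler_pdivrMr// mul1r lerDl.
move: zN; set I := Rintegral _ _ _; set u := average _ N; set w := average _ N.
set v := average (fun n => phi _) N.
move=> zN Cw uv; have -> : I - v = (I - u) + (u - v) by rewrite addrA subrK.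
rewrite (le_lt_trans (ler_normD _ _))//; rewrite distrC in uv.
move: zN Cw uv; lra.
Qed.

End MinimalAverages.

Theorem corollary4 (R : realType) (X : metricType R) (f : X -> X)
    (a : nat -> nat) :
  compact [set: X] ->
  continuous f ->
  uniformly_behaved R a ->
  MMA a f ->
  MUEMLS a f ->
  forall phi : X -> R[i]^o, continuous phi ->
  forall (K : minimal_subset f) (x : X), basin a f K x ->
  forall nu : probability (borel (minimal_space K)) R,
    invariant_measure (minimal_restrict K) nu ->
    (average (fun n => phi (iter (a n) f x)) : nat -> R[i]^o) @ \oo -->
      (cintegral nu (fun y : minimal_space K => phi (\val y)) : R[i]^o).
Proof.
move=> cX cf ua _ mue phi cphi K x bx nu inv; have [ueK mlsK] := mue K.
apply: cvg_complex; under eq_fun do rewrite average_complex /=.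
  apply: (@basin_average_cvg R X f a cX cf ua K ueK mlsK nu inv
    (fun x => complex.Re (phi x)) x bx).
  by move=> y; exact: cvg_Re (cphi y).
apply: (@basin_average_cvg R X f a cX cf ua K ueK mlsK nu inv
  (fun x => complex.Im (phi x)) x bx).
by move=> y; exact: cvg_Im (cphi y).
Qed.
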